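(* For all $n\ge 1$, $$\omega \tilde W_n(\mathbf{x},t) = \sum_{\lambda\vdash n}\Big(A_{l(\lambda)-1}(t)\sum_{i=1}^{l(\lambda)}\lambda_i t^{\lambda_i}\prod_{j\in\{1,\dots,l(\lambda)\}\setminus\{i\}}[\lambda_j]_t\Big)\frac{p_\lambda(\mathbf{x})}{z_\lambda},$$ where $\lambda=(\lambda_1\ge\lambda_2\ge\cdots\ge\lambda_{l(\lambda)})$.
   Context: For $n\ge 1$, $W_n$ is the set of Smirnov words of length $n$: words $w=w_1\cdots w_n$ over the positive integers with $w_i\ne w_{i+1}$ for all $1\le i\le n-1$ (the first and last letters may be equal). Let $\mathbf{x}=x_1,x_2,\dots$ be indeterminates and $x_w:=x_{w_1}\cdots x_{w_n}$. The cyclic descent number is $\mathrm{cdes}(w):=|\{i\in\{1,\dots,n\}: w_i>w_{i+1}\}|$, where $w_{n+1}:=w_1$. Define $\tilde W_n(\mathbf{x},t):=\sum_{w\in W_n} t^{\mathrm{cdes}(w)}x_w$; it is a polynomial in $t$ with symmetric function coefficients. $\omega$ is the standard involution on symmetric functions taking $e_n$ to $h_n$, applied coefficientwise in $t$. $p_\lambda$ is the power sum symmetric function, $z_\lambda:=\prod_{i\ge1} i^{m_i}m_i!$ where $\lambda$ has $m_i$ parts of size $i$, and $l(\lambda)$ is the number of parts of $\lambda$. $A_m(t):=\sum_{\sigma\in\mathfrak{S}_m}t^{\mathrm{des}(\sigma)}$ is the Eulerian polynomial for $m\ge1$ (with $\mathrm{des}$ the number of descents), and by convention $A_0(t):=t^{-1}$.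 $[m]_t:=1+t+\cdots+t^{m-1}$. *)

(* Defs.v *)
From HB Require Import structures.
From mathcomp Require Import all_boot all_order all_fingroup all_algebra.
From mathcomp Require Import mpoly.
From mathcomp Require boolp.

Set Implicit Arguments.
Unset Strict Implicit.
Unset Printing Implicit Defensive.

Import GRing.Theory.
Local Open Scope ring_scope.
Local Obligation Tactic := idtac.

(* Symmetric functions in the infinitely many indeterminates x_1, x_2, ... are
   encoded as in Macdonald's book: a symmetric function over R is a family, for
   all N, of its images f(x_1, ..., x_N) = f(x_1, ..., x_N, 0, 0, ...), that is,
   a family of symmetric polynomials of bounded degree, compatible with the
   substitutions x_(N+1) := 0.  The variable x_i is 'X_j with j = i - 1. *)

Definition setlast0 (R : comNzRingType) (N : nat) :
    {mpoly R[N.+1]} -> {mpoly R[N]} :=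
  comp_mpoly
    [tuple (if unlift ord_max i is Some j then 'X_j else 0) | i < N.+1].

HB.instance Definition _ (R : comNzRingType) N :=
  GRing.RMorphism.copy (@setlast0 R N) (comp_mpoly _).
HB.instance Definition _ (R : comNzRingType) N :=
  GRing.Linear.copy (@setlast0 R N) (comp_mpoly _).

Record symfun (R : comNzRingType) := SymFun {
  restr_vars :> forall N, {mpoly R[N]};
  symfun_sym : forall N, restr_vars N \is symmetric;
  symfun_compat : forall N, setlast0 (restr_vars N.+1) = restr_vars N;
  symfun_bounded : exists d, forall N, (msize (restr_vars N) <= d)%N
}.

Lemma symfunP (R : comNzRingType) (f g : symfun R) :
  (forall N, f N = g N) -> f = g.
Proof.
case: f g => [f f1 f2 f3] [g g1 g2 g3] /= fg.
have E : f = g by apply: boolp.functional_extensionality_dep.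
by subst g; congr SymFun; apply: boolp.Prop_irrelevance.
Qed.

HB.instance Definition _ (R : comNzRingType) := boolp.gen_eqMixin (symfun R).
HB.instance Definition _ (R : comNzRingType) :=
  boolp.gen_choiceMixin (symfun R).

Section Ring.
Variable R : comNzRingType.
Implicit Types f g h : symfun R.

Program Definition sf_zero : symfun R := @SymFun R (fun N => 0) _ _ _.
Next Obligation. by move=> N /=; apply: rpred0. Qed.
Next Obligation. by move=> N /=; apply: raddf0. Qed.
Next Obligation. by exists 0%N => N; rewrite msize0. Qed.

Program Definition sf_one : symfun R := @SymFun R (fun N => 1) _ _ _.
Next Obligation. by move=> N /=; apply: rpred1. Qed.
Next Obligation. by move=> N /=; apply: rmorph1. Qed.
Next Obligation. by exists 1%N => N; rewrite msize1. Qed.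

Program Definition sf_opp f : symfun R := @SymFun R (fun N => - f N) _ _ _.
Next Obligation. by move=> f N /=; rewrite rpredN symfun_sym. Qed.
Next Obligation. by move=> f N /=; rewrite raddfN /= symfun_compat. Qed.
Next Obligation.
by move=> f; have [d fd] := symfun_bounded f; exists d => N; rewrite mmeasureN.
Qed.

Program Definition sf_add f g : symfun R :=
  @SymFun R (fun N => f N + g N) _ _ _.
Next Obligation. by move=> f g N /=; rewrite rpredD ?symfun_sym. Qed.
Next Obligation. by move=> f g N /=; rewrite raddfD /= !symfun_compat. Qed.
Next Obligation.
move=> f g; have [d fd] := symfun_bounded f; have [d' gd] := symfun_bounded g.
exists (maxn d d') => N; apply: leq_trans (mmeasureD_le _ _ _) _.
by rewrite geq_max !leq_max fd gd orbT.
Qed.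

Program Definition sf_mul f g : symfun R :=
  @SymFun R (fun N => f N * g N) _ _ _.
Next Obligation. by move=> f g N /=; rewrite rpredM ?symfun_sym. Qed.
Next Obligation. by move=> f g N /=; rewrite rmorphM /= !symfun_compat. Qed.
Next Obligation.
move=> f g; have [d fd] := symfun_bounded f; have [d' gd] := symfun_bounded g.
exists (d + d').+1 => N; apply: leq_trans (msizeM_le _ _) _.
by rewrite ltnS leq_add.
Qed.

Program Definition sf_scale (c : R) f : symfun R :=
  @SymFun R (fun N => c *: f N) _ _ _.
Next Obligation. by move=> c f N /=; rewrite rpredZ ?symfun_sym. Qed.
Next Obligation. by move=> c f N /=; rewrite linearZ /= symfun_compat. Qed.
Next Obligation.
move=> c f; have [d fd] := symfun_bounded f.
by exists d => N; apply: leq_trans (msizeZ_le _ _) _.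
Qed.

Fact sf_addA : associative sf_add.
Proof. by move=> f g h; apply: symfunP => N /=; rewrite addrA. Qed.
Fact sf_addC : commutative sf_add.
Proof. by move=> f g; apply: symfunP => N /=; rewrite addrC. Qed.
Fact sf_add0 : left_id sf_zero sf_add.
Proof. by move=> f; apply: symfunP => N /=; rewrite add0r. Qed.
Fact sf_addN : left_inverse sf_zero sf_opp sf_add.
Proof. by move=> f; apply: symfunP => N /=; rewrite addNr. Qed.

HB.instance Definition _ :=
  GRing.isZmodule.Build (symfun R) sf_addA sf_addC sf_add0 sf_addN.

Fact sf_mulA : associative sf_mul.
Proof. by move=> f g h; apply: symfunP => N /=; rewrite mulrA. Qed.
Fact sf_mulC : commutative sf_mul.
Proof. by move=> f g; apply: symfunP => N /=; rewrite mulrC. Qed.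
Fact sf_mul1 : left_id sf_one sf_mul.
Proof. by move=> f; apply: symfunP => N /=; rewrite mul1r. Qed.
Fact sf_mulDl : left_distributive sf_mul sf_add.
Proof. by move=> f g h; apply: symfunP => N /=; rewrite mulrDl. Qed.
Fact sf_one_neq0 : sf_one != 0 :> symfun R.
Proof.
by apply/eqP => /(congr1 (fun f : symfun R => f 0)) /eqP; rewrite /= oner_eq0.
Qed.

HB.instance Definition _ :=
  GRing.Zmodule_isComNzRing.Build (symfun R)
    sf_mulA sf_mulC sf_mul1 sf_mulDl sf_one_neq0.

Fact sf_scaleA a b f : sf_scale a (sf_scale b f) = sf_scale (a * b) f.
Proof. by apply: symfunP => N /=; rewrite scalerA. Qed.
Fact sf_scale1 : left_id 1 sf_scale.
Proof. by move=> f; apply: symfunP => N /=; rewrite scale1r. Qed.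
Fact sf_scaleDr : right_distributive sf_scale +%R.
Proof. by move=> a f g; apply: symfunP => N /=; rewrite scalerDr. Qed.
Fact sf_scaleDl f : {morph sf_scale^~ f : a b / a + b}.
Proof. by move=> a b; apply: symfunP => N /=; rewrite scalerDl. Qed.

HB.instance Definition _ :=
  GRing.Zmodule_isLmodule.Build R (symfun R)
    sf_scaleA sf_scale1 sf_scaleDr sf_scaleDl.

Fact sf_scaleAl (c : R) f g : c *: (f * g) = (c *: f) * g.
Proof. by apply: symfunP => N /=; rewrite scalerAl. Qed.

HB.instance Definition _ :=
  GRing.Lmodule_isLalgebra.Build R (symfun R) sf_scaleAl.
HB.instance Definition _ := GRing.Lalgebra_isComAlgebra.Build R (symfun R).

Definition sf_restr N (f : symfun R) : {mpoly R[N]} := f N.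

Fact sf_restr_linear N : linear (sf_restr N).
Proof. by []. Qed.
Fact sf_restr_monoid N : monoid_morphism (sf_restr N).
Proof. by []. Qed.

HB.instance Definition _ N :=
  GRing.isLinear.Build R (symfun R) {mpoly R[N]} _ (sf_restr N)
    (sf_restr_linear N).
HB.instance Definition _ N :=
  GRing.isMonoidMorphism.Build (symfun R) {mpoly R[N]} (sf_restr N)
    (sf_restr_monoid N).

Lemma setlast0X N (m : 'X_{1..N.+1}) :
  setlast0 'X_[R, m] =
    if m ord_max == 0%N then 'X_[[multinom m (widen_ord (leqnSn N) i) | i < N]]
    else 0.
Proof.
rewrite /setlast0 comp_mpolyX big_ord_recr /= tnth_mktuple unlift_none.
case: eqP => [->|/eqP m0]; last first.
  by rewrite expr0n (negbTE m0) mulr0.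
rewrite expr0 mulr1 [RHS]mpolyXE_id; apply: eq_bigr => i _.
rewrite tnth_mktuple mnmE.
have -> : widen_ord (leqnSn N) i = lift ord_max i.
  by apply: val_inj; rewrite /= /bump leqNgt ltn_ord.
by rewrite liftK.
Qed.

Lemma mcoeff_setlast0 N (p : {mpoly R[N.+1]}) (m : 'X_{1..N}) :
  (setlast0 p)@_m = p@_(mnmwiden m).
Proof.
have -> : setlast0 p = \sum_(m' <- msupp p) setlast0 (p@_m' *: 'X_[m']).
  by rewrite {1}[p]mpolyE linear_sum.
have -> : p@_(mnmwiden m) =
    \sum_(m' <- msupp p) (p@_m' *: 'X_[m'])@_(mnmwiden m).
  by rewrite {1}[p]mpolyE raddf_sum.
rewrite raddf_sum; apply: eq_bigr => m' _ /=.
rewrite linearZ /= !mcoeffZ setlast0X; congr (_ * _).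
rewrite mcoeffX; case: eqP => [m0|m0].
  rewrite mcoeffX; congr (nat_of_bool _)%:R; apply/eqP/eqP => [/mnmP E|->].
    apply/mnmP => i; case: (unliftP ord_max i) => [j ->|->].
      have -> : lift ord_max j = widen_ord (leqnSn N) j.
        by apply: val_inj; rewrite /= /bump leqNgt ltn_ord.
      by have := E j; rewrite mnmE mnmwiden_widen.
    by rewrite mnmwiden_ordmax.
  by apply/mnmP => i; rewrite mnmE mnmwiden_widen.
rewrite mcoeff0; case: eqP => // E.
by case: m0; rewrite E mnmwiden_ordmax.
Qed.

Lemma mdeg_mnmwiden N (m : 'X_{1..N}) : mdeg (mnmwiden m) = mdeg m.
Proof.
rewrite !mdegE big_ord_recr /= mnmwiden_ordmax addn0.
by apply: eq_bigr => i _; rewrite mnmwiden_widen.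
Qed.

Program Definition sf_e (k : nat) : symfun R :=
  @SymFun R (fun N => mesym N R k) _ _ _.
Next Obligation. by move=> k N /=; apply: mesym_sym. Qed.
Next Obligation.
move=> k N; apply/mpolyP => m; rewrite mcoeff_setlast0 !mcoeff_mesym.
congr (_%:R); rewrite /mechar mdeg_mnmwiden; congr (_ && _).
apply/idP/idP => /forallP H; apply/forallP => i.
  by have := H (widen_ord (leqnSn N) i); rewrite mnmwiden_widen.
case: (unliftP ord_max i) => [j ->|->]; last by rewrite mnmwiden_ordmax.
have -> : lift ord_max j = widen_ord (leqnSn N) j.
  by apply: val_inj; rewrite /= /bump leqNgt ltn_ord.
by rewrite mnmwiden_widen.
Qed.
Next Obligation.
move=> k; exists k.+1 => N; rewrite msizeE; apply/bigmax_leqP_seq => m.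
by rewrite mem_msupp_mesym => /andP[/eqP -> _] _.
Qed.

Definition mhsym N (k : nat) : {mpoly R[N]} :=
  \sum_(m : 'X_{1..N < k.+1} | mdeg m == k) 'X_[m].

Lemma mcoeff_mhsym N k (m : 'X_{1..N}) : (mhsym N k)@_m = (mdeg m == k)%:R.
Proof.
rewrite /mhsym raddf_sum /=; case: (eqVneq (mdeg m) k) => mk.
  have lt_m : (mdeg m < k.+1)%N by rewrite mk.
  rewrite (bigD1 (BMultinom lt_m)) /= ?mk // mcoeffX eqxx big1 ?addr0 // => m'.
  case/andP=> _ ne; rewrite mcoeffX; case: eqP => // E.
  by case/eqP: ne; apply: val_inj.
rewrite big1 // => m' /eqP m'k; rewrite mcoeffX; case: eqP => // E.
by move: mk; rewrite -E m'k eqxx.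
Qed.

Program Definition sf_h (k : nat) : symfun R :=
  @SymFun R (fun N => mhsym N k) _ _ _.
Next Obligation.
move=> k N; apply/issymP => s; apply/mpolyP => m.
by rewrite mcoeff_sym !mcoeff_mhsym mdeg_mperm.
Qed.
Next Obligation.
move=> k N; apply/mpolyP => m.
by rewrite mcoeff_setlast0 !mcoeff_mhsym mdeg_mnmwiden.
Qed.
Next Obligation.
move=> k; exists k.+1 => N; rewrite msizeE; apply/bigmax_leqP_seq => m.
by rewrite mcoeff_msupp mcoeff_mhsym;
  case: (eqVneq (mdeg m) k) => [->|_]; rewrite ?eqxx.
Qed.

(* p_0 is set to 1, as sum_i x_i^0 is not a symmetric function *)
Program Definition sf_p (k : nat) : symfun R :=
  @SymFun R (fun N => if k == 0%N then 1 else \sum_(i < N) 'X_i ^+ k) _ _ _.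
Next Obligation.
move=> k N; case: eqP => _; first exact: rpred1.
apply/issymP => s; rewrite raddf_sum /= [RHS](reindex_inj (@perm_inj _ s)) /=.
by apply: eq_bigr => i _; rewrite rmorphXn /= /msym mmapX mmap1U.
Qed.
Next Obligation.
move=> k N; case: eqP => [_|/eqP k0]; first exact: rmorph1.
rewrite raddf_sum /= big_ord_recr /= rmorphXn /= [X in X ^+ k]comp_mpolyXU.
rewrite -tnth_nth tnth_mktuple unlift_none expr0n (negbTE k0) addr0.
apply: eq_bigr => i _; rewrite rmorphXn /= [X in X ^+ k]comp_mpolyXU.
rewrite -tnth_nth tnth_mktuple.
have -> : widen_ord (leqnSn N) i = lift ord_max i.
  by apply: val_inj; rewrite /= /bump leqNgt ltn_ord.
by rewrite liftK.
Qed.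
Next Obligation.
move=> k; exists k.+1 => N; case: eqP => [_|k0]; first by rewrite msize1.
apply: leq_trans (mmeasure_sum _ _ _ _) _; apply/bigmax_leqP => i _.
by rewrite mpolyXn msizeX mdegMn mdeg1 mul1n.
Qed.

End Ring.

Arguments sf_e {R} k.
Arguments sf_h {R} k.
Arguments sf_p {R} k.

Section Omega.
Variable R : comNzRingType.
Implicit Types (f g : symfun R) (u : nat -> symfun R).

(* The polynomial P evaluated at u 1, u 2, ..., u k. *)
Definition sf_eval u k (P : {mpoly R[k]}) : symfun R :=
  mmap (GRing.in_alg (symfun R)) (fun i : 'I_k => u i.+1) P.

HB.instance Definition _ u k :=
  GRing.RMorphism.copy (@sf_eval u k) (mmap _ _).

Lemma sf_evalZ u k c (P : {mpoly R[k]}) :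
  sf_eval u (c *: P) = c *: sf_eval u P.
Proof. by rewrite /sf_eval mmapZ /= mulr_algl. Qed.

Lemma sf_evalX u k (m : 'X_{1..k}) :
  sf_eval u 'X_[R, m] = \prod_(i < k) u i.+1 ^+ m i.
Proof. by rewrite /sf_eval mmapX. Qed.

Lemma sf_evalXU u k (i : 'I_k) : sf_eval u 'X_i = u i.+1.
Proof. by rewrite /sf_eval mmapX mmap1U. Qed.

Lemma sf_evalE u k (P : {mpoly R[k]}) :
  sf_eval u P = \sum_(m <- msupp P) P@_m *: \prod_(i < k) u i.+1 ^+ m i.
Proof. by apply: eq_bigr => m _; rewrite /= mulr_algl. Qed.

Lemma sf_eval_restr u k (P : {mpoly R[k]}) N :
  sf_eval u P N = P \mPo [tuple u i.+1 N | i < k].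
Proof.
rewrite -[LHS]/(sf_restr N (sf_eval u P)) sf_evalE raddf_sum comp_mpolyE /=.
apply: eq_bigr => m _; congr (_ *: _).
rewrite -[LHS]/(sf_restr N _) rmorph_prod.
by apply: eq_bigr => i _; rewrite rmorphXn tnth_mktuple.
Qed.

Definition mpoly_widen k l (le_kl : (k <= l)%N) (P : {mpoly R[k]}) :
    {mpoly R[l]} :=
  P \mPo [tuple 'X_(widen_ord le_kl i) | i < k].

Lemma sf_eval_widen u k l (le_kl : (k <= l)%N) (P : {mpoly R[k]}) :
  sf_eval u (mpoly_widen le_kl P) = sf_eval u P.
Proof.
rewrite /mpoly_widen comp_mpolyE raddf_sum sf_evalE /=; apply: eq_bigr => m _.
rewrite sf_evalZ rmorph_prod; congr (_ *: _); apply: eq_bigr => i _.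
by rewrite rmorphXn /= tnth_mktuple sf_evalXU.
Qed.

Lemma msizeM_S N (p q : {mpoly R[N]}) a b :
  (msize p <= a.+1)%N -> (msize q <= b.+1)%N -> (msize (p * q) <= (a + b).+1)%N.
Proof.
move=> pa qb; rewrite msizeE; apply/bigmax_leqP_seq => m mpq _.
case/msuppM_le/allpairsP: mpq => -[m1 m2] /= [m1p m2q ->].
rewrite mdegD ltnS; apply: leq_add; rewrite -ltnS.
  exact: leq_trans (msize_mdeg_lt m1p) pa.
exact: leq_trans (msize_mdeg_lt m2q) qb.
Qed.

Lemma sf_evale_size k (P : {mpoly R[k]}) d N :
  (mweight P <= d.+1)%N -> (msize (sf_eval sf_e P N) <= d.+1)%N.
Proof.
move=> Pd; rewrite sf_eval_restr comp_mpolyE.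
apply: leq_trans (mmeasure_sum _ _ _ _) _; apply/bigmax_leqP_seq => m mP _.
apply: leq_trans (msizeZ_le _ _) _.
have wm : (mnmwgt m <= d)%N by rewrite -ltnS (leq_trans _ Pd) ?mmeasure_mnm_lt.
suff: (msize (\prod_(i < k) tnth [tuple sf_e i.+1 N | i < k] i ^+ m i
         : {mpoly R[N]}) <= (mnmwgt m).+1)%N by move/leq_trans; apply.
rewrite /mnmwgt; elim/big_rec2: _ => [|i p s _ sp]; first by rewrite msize1.
apply: msizeM_S sp; rewrite tnth_mktuple.
have e_size : (msize (mesym N R i.+1) <= i.+1.+1)%N.
  rewrite msizeE; apply/bigmax_leqP_seq => m'.
  by rewrite mem_msupp_mesym => /andP[/eqP -> _] _.
elim: (m i) => [|j IH]; first by rewrite expr0 msize1.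
by rewrite exprS mulSn; apply: msizeM_S.
Qed.

Lemma symfun_eq0 f d :
  (forall N, msize (f N) <= d.+1)%N -> f d = 0 -> f = 0.
Proof.
move=> fd fd0.
have up N : (d <= N)%N -> f N = 0 -> f N.+1 = 0.
  move=> dN fN0; apply/mpolyP => m; rewrite mcoeff0.
  have [md|md] := leqP (mdeg m) d; last first.
    apply: memN_msupp_eq0; apply: msize_mdeg_ge.
    exact: leq_trans (fd _) md.
  have [i mi0] : exists i, m i = 0%N.
    case: (pickP (fun i => m i == 0%N)) => [i /eqP ?|m_gt0]; first by exists i.
    suff: (N.+1 <= mdeg m)%N.
      by move=> Nm; have := leq_trans Nm (leq_trans md dN); rewrite ltnn.
    rewrite mdegE -[X in (X <= _)%N]card_ord -sum1_card; apply: leq_sum => i _.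
    by rewrite lt0n m_gt0.
  rewrite -(msym_coeff m (tperm i ord_max) (symfun_sym f N.+1)).
  set m1 := [multinom _ | _ < _].
  have m1E : m1 =
      mnmwiden [multinom m1 (widen_ord (leqnSn N) j) | j < N].
    apply/mnmP => j; case: (unliftP ord_max j) => [j' ->|->].
      have -> : lift ord_max j' = widen_ord (leqnSn N) j'.
        by apply: val_inj; rewrite /= /bump leqNgt ltn_ord.
      by rewrite mnmwiden_widen mnmE.
    by rewrite mnmwiden_ordmax mnmE tpermR.
  by rewrite m1E -mcoeff_setlast0 symfun_compat fN0 mcoeff0.
have ge N : f (d + N)%N = 0.
  elim: N => [|N IH]; first by rewrite addn0.
  by rewrite addnS; apply: up => //; apply: leq_addr.
have down N : f N.+1 = 0 -> f N = 0.
  by move=> fN0; rewrite -symfun_compat fN0 raddf0.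
apply: symfunP => N; rewrite -[RHS]/(0 : {mpoly R[N]}).
have: f (N + d)%N = 0 by rewrite addnC.
by elim: d {fd fd0 up ge} => [|d IH]; rewrite ?addn0 // addnS => /down.
Qed.

Lemma sf_evale_surj f : exists k (P : {mpoly R[k]}), f = sf_eval sf_e P.
Proof.
have [d fd] := symfun_bounded f.
have [P [PE Pw]] := sym_fundamental (symfun_sym f d).
exists d, P; apply/eqP; rewrite -subr_eq0; apply/eqP.
have fd' N : (msize (f N) <= d.+1)%N by apply: leq_trans (fd N) _.
apply: (@symfun_eq0 _ d) => [N|].
  apply: leq_trans (mmeasureD_le _ _ _) _; rewrite mmeasureN geq_max fd' /=.
  by apply: sf_evale_size; apply: leq_trans Pw _.
rewrite -[LHS]/(f d - sf_eval sf_e P d) sf_eval_restr.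
by rewrite -[X in X - _]PE subrr.
Qed.

Lemma sf_evale_inj k (P Q : {mpoly R[k]}) :
  sf_eval sf_e P = sf_eval sf_e Q -> P = Q.
Proof.
move/(congr1 (fun f : symfun R => f k)); rewrite !sf_eval_restr.
exact: msym_fundamental_un.
Qed.

Lemma omega_exists f :
  exists g, exists k (P : {mpoly R[k]}),
    f = sf_eval sf_e P /\ g = sf_eval sf_h P.
Proof.
have [k [P fP]] := sf_evale_surj f.
by exists (sf_eval sf_h P), k, P.
Qed.

(* The image under omega of a polynomial in e_1, e_2, ... is the same polynomial
   in h_1, h_2, ...; see omegaP and omega_e. *)
Definition omega f : symfun R := sval (boolp.cid (omega_exists f)).

Lemma omegaP k (P : {mpoly R[k]}) :
  omega (sf_eval sf_e P) = sf_eval sf_h P.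
Proof.
rewrite /omega; case: boolp.cid => g /= [l [Q [PQ gQ]]]; rewrite {g}gQ.
rewrite -(sf_eval_widen sf_h (leq_maxl k l) P).
rewrite -(sf_eval_widen sf_h (leq_maxr k l) Q); congr sf_eval.
by apply: sf_evale_inj; rewrite !sf_eval_widen.
Qed.

Lemma sf_evale_surj2 f g : exists k (P Q : {mpoly R[k]}),
  f = sf_eval sf_e P /\ g = sf_eval sf_e Q.
Proof.
have [k [P ->]] := sf_evale_surj f; have [l [Q ->]] := sf_evale_surj g.
exists (maxn k l), (mpoly_widen (leq_maxl k l) P), (mpoly_widen (leq_maxr k l) Q).
by rewrite !sf_eval_widen.
Qed.

Fact omega_linear : linear omega.
Proof.
move=> c f g; have [k [P [Q [-> ->]]]] := sf_evale_surj2 f g.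
by rewrite -sf_evalZ -rmorphD !omegaP rmorphD /= sf_evalZ.
Qed.

Fact omega_monoid : monoid_morphism omega.
Proof.
split=> [|f g].
  by rewrite -[1 in LHS](rmorph1 (@sf_eval sf_e 0)) omegaP rmorph1.
have [k [P [Q [-> ->]]]] := sf_evale_surj2 f g.
by rewrite -rmorphM !omegaP rmorphM.
Qed.

HB.instance Definition _ :=
  GRing.isLinear.Build R (symfun R) (symfun R) _ omega omega_linear.
HB.instance Definition _ :=
  GRing.isMonoidMorphism.Build (symfun R) (symfun R) omega omega_monoid.

Lemma omega_e k : omega (sf_e k) = sf_h k.
Proof.
case: k => [|k].
  have -> : sf_e 0 = 1 :> symfun R.
    by apply: symfunP => N; apply: mesym0E.
  rewrite rmorph1; apply: symfunP => N; apply/mpolyP => m.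
  by rewrite /= mcoeff_mhsym mcoeff1 mdeg_eq0.
by rewrite -(sf_evalXU sf_e (ord_max : 'I_k.+1)) omegaP sf_evalXU.
Qed.

End Omega.

(* Words are sequences of letters in nat, and a permutation s of {0, ..., m-1}
   is identified with the word s(0) ... s(m-1). *)

Definition smirnov (w : seq nat) : bool := sorted (fun a b => a != b) w.

Definition des (w : seq nat) : nat :=
  count (fun i => nth 0%N w i.+1 < nth 0%N w i)%N (iota 0 (size w).-1).

Definition cdes (w : seq nat) : nat :=
  count (fun i => nth 0%N w (i.+1 %% size w) < nth 0%N w i)%N
        (iota 0 (size w)).

(* Coefficients are taken in the field Q(t), in which t^-1 and 1 / z_lambda make
   sense; as omega is Q(t)-linear, it acts coefficientwise in t. *)
Definition Qt : fieldType := {fraction {poly rat}}.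
Definition t : Qt := @FracField.tofrac {poly rat} 'X.

(* The image in N variables of the sum of t^cdes(w) x_w over all Smirnov words w
   of length n: a word having a letter of index >= N contributes 0. *)
Definition Wtilde (n N : nat) : {mpoly Qt[N]} :=
  \sum_(w : n.-tuple 'I_N | smirnov (map val w))
    t ^+ cdes (map val w) *: \prod_(i <- w) 'X_i.

Definition eulerian (m : nat) : Qt :=
  if m == 0%N then t^-1
  else \sum_(s : 'S_m) t ^+ des [seq val (s i) | i <- enum 'I_m].

Definition tint (m : nat) : Qt := \sum_(i < m) t ^+ i.

Definition is_intpart (n : nat) (la : seq nat) : bool :=
  [&& sorted geq la, 0%N \notin la & sumn la == n].

Record intpart (n : nat) := IntPart {
  parts :> seq nat;
  _ : is_intpart n parts
}.

HB.instance Definition _ n := [isSub for @parts n].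
HB.instance Definition _ n := [Countable of intpart n by <:].

Section IntPartFinite.
Variable n : nat.

Definition intpart_enc (la : intpart n) : {bseq n of 'I_n.+1} :=
  insub_bseq n (map inord la).
Definition intpart_dec (b : {bseq n of 'I_n.+1}) : option (intpart n) :=
  insub (map val b).

Lemma intpart_encK : pcancel intpart_enc intpart_dec.
Proof.
case=> la Hla; case/and3P: (Hla) => _ la0 /eqP sn.
have size_la : (size la <= n)%N.
  rewrite -sn; elim: la la0 {Hla sn} => //= a s IH.
  by rewrite inE negb_or eq_sym -lt0n => /andP[a0 /IH]; apply: (@leq_add 1).
have le_la i : i \in la -> (i <= n)%N.
  by rewrite -sn sumnE => ila; rewrite (big_rem i) //= leq_addr.
rewrite /intpart_dec /intpart_enc.
have -> : map val (insub_bseq n (map (@inord n) la)) = la.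
  rewrite val_insubd size_map size_la -map_comp -[RHS]map_id.
  by apply/eq_in_map => i /le_la in_; rewrite /= inordK.
by rewrite insubT; congr Some; apply: val_inj.
Qed.

HB.instance Definition _ : isFinite (intpart n) := PCanIsFinite intpart_encK.
End IntPartFinite.

Definition zpart (la : seq nat) : nat :=
  \prod_(1 <= i < (sumn la).+1) (i ^ count_mem i la * (count_mem i la)`!).

Definition sf_ppart (la : seq nat) : symfun Qt := \prod_(k <- la) sf_p k.

(* Main.v *)
Require Import Defs.
From HB Require Import structures.
From mathcomp Require Import all_boot all_order all_fingroup all_algebra.
From mathcomp Require Import mpoly ring.
From mathcomp Require boolp.

Set Implicit Arguments.
Unset Strict Implicit.
Unset Printing Implicit Defensive.

Import GRing.Theory.
Local Open Scope ring_scope.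

(* Write [E(z) = sum_k e_k z^k], [H(z) = sum_k h_k z^k], [P(z) = sum_k p_k z^k]
   and let [theta = z d/dz].  For Smirnov words [w_1 ... w_n b] over N letters,
   let [R_a] be the generating function in which passing from a letter [a] to
   [w_1] costs [t] when [w_1 < a].  It satisfies
     [(1 + x_a z) R_(a+1) = (1 + t x_a z) R_a - (1 - t) [a = b]] and
     [R_N = t R_0],
   which can be solved for [R_b]; summing [x_b z R_b] over [b] yields
     [sum_n W_n z^n = (1 - t) / t * theta (E(tz)) / (E(tz) - t E(z))].
   Under omega, [E] becomes [H].  With [u = sum_k [k]_t p_k z^k / k], Newton's
   identity [theta H = P H] gives [H(z) = exp((1 - t) u) H(tz)], so that the
   image is [P(tz) * (1 - t) / t / (1 - t exp((1 - t) u))], which is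
   [P(tz) * sum_m A_m(t) u^m / m!] by the exponential generating function of
   the Eulerian polynomials.  Removing one part from a partition then identifies
   the coefficients of this product with the stated sums over partitions. *)

(** * Formal power series *)

Record fps (A : Type) := Fps { fcoef :> nat -> A }.

Lemma fpsP (A : Type) (f g : fps A) : (forall n, f n = g n) <-> f = g.
Proof.
split=> [|-> //]; case: f g => [f] [g] /= fg.
by congr Fps; apply: boolp.funext.
Qed.

HB.instance Definition _ (A : Type) := boolp.gen_eqMixin (fps A).
HB.instance Definition _ (A : Type) := boolp.gen_choiceMixin (fps A).

Section FpsRing.
Variable A : comNzRingType.
Implicit Types f g h u : fps A.

Definition fps_zero : fps A := Fps (fun=> 0).
Definition fps_opp f := Fps (fun n => - f n).
Definition fps_add f g := Fps (fun n => f n + g n).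

Fact fps_addA : associative fps_add.
Proof. by move=> f g h; apply/fpsP => n /=; rewrite addrA. Qed.
Fact fps_addC : commutative fps_add.
Proof. by move=> f g; apply/fpsP => n /=; rewrite addrC. Qed.
Fact fps_add0 : left_id fps_zero fps_add.
Proof. by move=> f; apply/fpsP => n /=; rewrite add0r. Qed.
Fact fps_addN : left_inverse fps_zero fps_opp fps_add.
Proof. by move=> f; apply/fpsP => n /=; rewrite addNr. Qed.

HB.instance Definition _ :=
  GRing.isZmodule.Build (fps A) fps_addA fps_addC fps_add0 fps_addN.

Definition fps_one : fps A := Fps (fun n => (n == 0%N)%:R).
Definition fps_mul f g := Fps (fun n => \sum_(i < n.+1) f i * g (n - i)%N).

Definition fps_trunc (N : nat) f : {poly A} := \poly_(i < N) f i.

Lemma coef_fps_trunc N f n : (n < N)%N -> (fps_trunc N f)`_n = f n.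
Proof. by move=> nN; rewrite coef_poly nN. Qed.

(** Coefficient [n] of a product involves only coefficients up to [n], so truncation transfers the
    ring laws of [{poly A}] to series. *)
Lemma fps_mul_poly f g (p q : {poly A}) n :
  (forall i, (i <= n)%N -> p`_i = f i) -> (forall i, (i <= n)%N -> q`_i =
      g i) ->
  fps_mul f g n = (p * q)`_n.
Proof.
move=> pf qg; rewrite coefM; apply: eq_bigr => i _.
by rewrite pf -1?ltnS // qg // leq_subr.
Qed.

Fact fps_mulC : commutative fps_mul.
Proof.
move=> f g; apply/fpsP => n.
have tr h i : (i <= n)%N -> (fps_trunc n.+1 h)`_i = h i.
  by move=> i_n; rewrite coef_fps_trunc.
by rewrite (fps_mul_poly (tr f) (tr g)) mulrC -(fps_mul_poly (tr g) (tr f)).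
Qed.

Fact fps_mulA : associative fps_mul.
Proof.
move=> f g h; apply/fpsP => n.
have tr k i : (i <= n)%N -> (fps_trunc n.+1 k)`_i = k i.
  by move=> i_n; rewrite coef_fps_trunc.
have trM k l i : (i <= n)%N ->
    (fps_trunc n.+1 k * fps_trunc n.+1 l)`_i = fps_mul k l i.
  move=> i_n; rewrite -(@fps_mul_poly k l) // => j j_i;
  by rewrite tr // (leq_trans j_i).
by rewrite (fps_mul_poly (tr f) (trM g h)) mulrA
  -(fps_mul_poly (trM f g) (tr h)).
Qed.

Fact fps_mul1 : left_id fps_one fps_mul.
Proof.
move=> f; apply/fpsP => n /=; rewrite big_ord_recl /=
    mul1r subn0 big1 ?addr0 //.
by move=> i _; rewrite mul0r.
Qed.

Fact fps_mulDl : left_distributive fps_mul +%R.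
Proof.
move=> f g h; apply/fpsP => n /=; rewrite -big_split /=.
by apply: eq_bigr => i _; rewrite mulrDl.
Qed.

Fact fps_one_neq0 : fps_one != 0 :> fps A.
Proof.
by apply/eqP => /(congr1 (fun f : fps A => f 0%N)) /eqP; rewrite /= oner_eq0.
Qed.

HB.instance Definition _ :=
  GRing.Zmodule_isComNzRing.Build (fps A)
    fps_mulA fps_mulC fps_mul1 fps_mulDl fps_one_neq0.

Definition coef_at n f : A := f n.
Fact coef_at_additive n : zmod_morphism (coef_at n).
Proof. by []. Qed.
HB.instance Definition _ n :=
  GRing.isZmodMorphism.Build (fps A) A (coef_at n) (coef_at_additive n).

Lemma fcoefD f g n : (f + g) n = f n + g n. Proof. by []. Qed.
Lemma fcoefB f g n : (f - g) n = f n - g n. Proof. by []. Qed.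
Lemma fcoef0 n : (0 : fps A) n = 0. Proof. by []. Qed.
Lemma fcoef1 n : (1 : fps A) n = (n == 0%N)%:R. Proof. by []. Qed.
Lemma fcoefM f g n : (f * g) n = \sum_(i < n.+1) f i * g (n - i)%N.
Proof. by []. Qed.
Lemma fcoefMn f m n : (f *+ m) n = f n *+ m.
Proof. exact: (raddfMn (coef_at n)). Qed.
Lemma fcoef_sum (I : Type) (r : seq I) (P : pred I) (F : I -> fps A) n :
  (\sum_(i <- r | P i) F i) n = \sum_(i <- r | P i) F i n.
Proof. exact: (raddf_sum (coef_at n)). Qed.

Lemma fcoefM0 f g : (f * g) 0%N = f 0%N * g 0%N.
Proof. by rewrite fcoefM big_ord1. Qed.

Definition fpsC (a : A) : fps A := Fps (fun n => if n == 0%N then a else 0).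

Lemma fcoefCM a f n : (fpsC a * f) n = a * f n.
Proof.
rewrite fcoefM big_ord_recl /= subn0 big1 ?addr0 //.
by move=> i _; rewrite mul0r.
Qed.

Fact fpsC_zmod : zmod_morphism fpsC.
Proof. by move=> a b; apply/fpsP => -[|n] /=; rewrite ?subr0. Qed.
Fact fpsC_monoid : monoid_morphism fpsC.
Proof.
split=> [|a b]; first by apply/fpsP => -[].
by apply/fpsP => -[|n]; rewrite fcoefCM //= mulr0.
Qed.
HB.instance Definition _ :=
  GRing.isZmodMorphism.Build A (fps A) fpsC fpsC_zmod.
HB.instance Definition _ :=
  GRing.isMonoidMorphism.Build A (fps A) fpsC fpsC_monoid.

Definition fpsX : fps A := Fps (fun n => (n == 1%N)%:R).

Lemma fcoefXM f n : (fpsX * f) n = if n is n'.+1 then f n' else 0.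
Proof.
rewrite fcoefM; case: n => [|n]; first by rewrite big_ord1 mul0r.
rewrite 2!big_ord_recl /= mul0r add0r mul1r subn1 big1 ?addr0 //.
by move=> i _; rewrite mul0r.
Qed.

Definition theta f : fps A := Fps (fun n => f n *+ n).

Lemma fcoef_theta f n : theta f n = f n *+ n. Proof. by []. Qed.

Arguments theta : simpl never.

Fact theta_zmod : zmod_morphism theta.
Proof. by move=> f g; apply/fpsP => n /=; rewrite mulrnBl. Qed.
HB.instance Definition _ :=
  GRing.isZmodMorphism.Build (fps A) (fps A) theta theta_zmod.

Lemma thetaM f g : theta (f * g) = theta f * g + f * theta g.
Proof.
apply/fpsP => n; rewrite fcoef_theta fcoefD !fcoefM -sumrMnl -big_split /=.
apply: eq_bigr => i _; rewrite mulrnAl mulrnAr -mulrnDr subnKC //.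
by rewrite -ltnS.
Qed.

Lemma theta_exp f m : theta (f ^+ m.+1) = f ^+ m * theta f *+ m.+1.
Proof.
elim: m => [|m IH]; first by rewrite expr0 mul1r mulr1n.
by rewrite exprS thetaM IH mulrnAr mulrA -exprS [theta f * _]mulrC -mulrS.
Qed.

Lemma theta_prod (F : nat -> fps A) N :
  theta (\prod_(0 <= c < N) F c) =
    \sum_(0 <= b < N)
      (\prod_(0 <= c < b) F c) * theta (F b) * \prod_(b.+1 <= c < N) F c.
Proof.
elim: N => [|N IH].
  rewrite !big_geq //; apply/fpsP => -[|n]; rewrite fcoef_theta fcoef1.
    by rewrite mulr0n.
  by rewrite mul0rn.
rewrite big_nat_recr //= [RHS]big_nat_recr //= thetaM IH mulr_suml.
rewrite (big_geq (leqnn N.+1)) mulr1; congr (_ + _).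
rewrite !big_nat; apply: eq_bigr => b /andP[_ bN].
by rewrite [in RHS]big_nat_recr //= mulrA.
Qed.

(* Substitution of [a z] for [z]. *)
Definition fps_scale (a : A) f : fps A := Fps (fun n => a ^+ n * f n).

Lemma fcoef_scale a f n : fps_scale a f n = a ^+ n * f n. Proof. by []. Qed.

Fact fps_scale_zmod a : zmod_morphism (fps_scale a).
Proof. by move=> f g; apply/fpsP => n /=; rewrite mulrBr. Qed.
Fact fps_scale_monoid a : monoid_morphism (fps_scale a).
Proof.
split=> [|f g]; apply/fpsP => n; rewrite fcoef_scale.
  by case: n => [|n]; rewrite ?mulr1 // mulr0.
rewrite !fcoefM mulr_sumr; apply: eq_bigr => i _; rewrite !fcoef_scale.
by rewrite mulrACA -exprD subnKC // -ltnS.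
Qed.
HB.instance Definition _ a :=
  GRing.isZmodMorphism.Build (fps A) (fps A) (fps_scale a) (fps_scale_zmod a).
HB.instance Definition _ a :=
  GRing.isMonoidMorphism.Build (fps A) (fps A) (fps_scale a)
    (fps_scale_monoid a).

Lemma theta_scale a f : theta (fps_scale a f) = fps_scale a (theta f).
Proof. by apply/fpsP => n /=; rewrite mulrnAr. Qed.

(** If [f * k = 0], coefficient [n] reads [k n] plus multiples of earlier coefficients of [k], so
    [k] vanishes by strong induction. *)
Lemma fps_mulI f : f 0%N = 1 -> injective ( *%R f).
Proof.
move=> f0 g h fgh; apply/eqP; rewrite -subr_eq0; apply/eqP.
have {fgh}: f * (g - h) = 0 by rewrite mulrBr fgh subrr.
move: (g - h) => k fk0; apply/fpsP => n; rewrite fcoef0.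
elim/ltn_ind: n => n IH.
have : (f * k) n = 0 by rewrite fk0.
rewrite fcoefM big_ord_recl f0 mul1r subn0 big1 ?addr0 // => i _.
by rewrite IH ?mulr0 // ltn_subrL /= (leq_ltn_trans _ (ltn_ord i)).
Qed.

Lemma fcoef_exp_small u g m n : u 0%N = 0 -> (n < m)%N -> (u ^+ m * g) n = 0.
Proof.
move=> u0; elim: m n => // m IH n nm.
rewrite exprS -mulrA fcoefM big_ord_recl u0 mul0r add0r big1 // => i _.
rewrite IH ?mulr0 // lift0; case: n i nm => [[]//|n] i nm.
by rewrite subSS (leq_ltn_trans (leq_subr _ _)).
Qed.

(** The substitution f(u), meant for [u 0 = 0]: then [u ^+ m] has order at least [m], and the sum
    may stop at [m = n]. *)
Definition fps_comp u f : fps A :=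
  Fps (fun n => \sum_(m < n.+1) f m * (u ^+ m) n).

Lemma fps_comp_widen u f n N : u 0%N = 0 -> (n < N)%N ->
  fps_comp u f n = \sum_(m < N) f m * (u ^+ m) n.
Proof.
move=> u0 nN; rewrite [RHS](bigID (fun m : 'I_N => (m < n.+1)%N)) /=.
rewrite -(big_ord_widen N (fun m => f m * (u ^+ m) n) nN).
rewrite [X in _ + X]big1 ?addr0 // => m; rewrite -ltnNge => nm.
by rewrite -[u ^+ m]mulr1 fcoef_exp_small // mulr0.
Qed.

(** Evaluating a truncation of [f] at [u] gives the right low coefficients, so that [hornerM] yields
    multiplicativity of substitution. *)
Lemma fps_comp_poly u f (p : {poly A}) n : u 0%N = 0 ->
  (forall i, (i <= n)%N -> p`_i = f i) ->
  (map_poly fpsC p).[u] n = fps_comp u f n.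
Proof.
move=> u0 pf; rewrite (horner_coef_wide (n := (n + size p).+1)); last first.
  by rewrite (leq_trans (size_poly _ _)) // leqW // leq_addl.
rewrite fcoef_sum; under eq_bigr do rewrite coef_map fcoefCM.
rewrite (@fps_comp_widen u f n (n + size p).+1) ?ltnS ?leq_addr //.
apply: eq_bigr => m _; have [mn|nm] := leqP m n; first by rewrite pf.
by rewrite -[u ^+ m]mulr1 fcoef_exp_small // !mulr0.
Qed.

Lemma fps_comp_is_zmod u : zmod_morphism (fps_comp u).
Proof.
move=> f g; apply/fpsP => n /=; rewrite -sumrB.
by apply: eq_bigr => m _; rewrite -mulrBl.
Qed.
HB.instance Definition _ u :=
  GRing.isZmodMorphism.Build (fps A) (fps A) (fps_comp u) (fps_comp_is_zmod u).

Lemma fps_compM u f g : u 0%N = 0 ->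
  fps_comp u (f * g) = fps_comp u f * fps_comp u g.
Proof.
move=> u0; apply/fpsP => n; pose tr := fps_trunc n.+1.
have trE h i : (i <= n)%N -> (tr h)`_i = h i.
  by move=> i_n; rewrite coef_fps_trunc.
rewrite -(@fps_comp_poly u (f * g) (tr f * tr g)) //; last first.
  move=> i i_n; rewrite -(@fps_mul_poly f g) // => j j_i;
  by rewrite trE // (leq_trans j_i).
rewrite rmorphM hornerM !fcoefM; apply: eq_bigr => i _.
have i_n : (i <= n)%N by rewrite -ltnS.
rewrite (@fps_comp_poly u f (tr f)) ?(@fps_comp_poly u g (tr g)) // => j j_i;
  rewrite trE //.
  exact: leq_trans j_i (leq_subr _ _).
exact: leq_trans j_i i_n.
Qed.

Lemma fps_compC u a : fps_comp u (fpsC a) = fpsC a.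
Proof.
apply/fpsP => n /=; rewrite big_ord_recl big1 ?addr0 /= => [|i _].
  by case: n => [|n] /=; rewrite ?mulr1 ?mulr0.
by rewrite mul0r.
Qed.

Lemma fps_comp1 u : fps_comp u 1 = 1.
Proof. by rewrite -(rmorph1 fpsC) fps_compC. Qed.

Lemma fps_compX u : u 0%N = 0 -> fps_comp u fpsX = u.
Proof.
move=> u0; apply/fpsP => -[|n] /=; first by rewrite big_ord1 mul0r u0.
rewrite 2!big_ord_recl /= mul0r add0r mul1r expr1 big1 ?addr0 // => i _.
by rewrite mul0r.
Qed.

Definition fps_deriv f : fps A := Fps (fun n => f n.+1 *+ n.+1).

(** Chain rule, from theta(u^m) = m u^(m-1) theta(u) and a shift of the summation index. *)
Lemma theta_comp u f : u 0%N = 0 ->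
  theta (fps_comp u f) = fps_comp u (fps_deriv f) * theta u.
Proof.
move=> u0; apply/fpsP => n.
have -> : (fps_comp u (fps_deriv f) * theta u) n =
    \sum_(m < n.+1) fps_deriv f m * (u ^+ m * theta u) n.
  rewrite fcoefM.
  under eq_bigr => i _ do
    rewrite (@fps_comp_widen u _ i n.+1) ?ltn_ord // mulr_suml.
  rewrite exchange_big; apply: eq_bigr => m _.
  by rewrite fcoefM mulr_sumr; apply: eq_bigr => i _; rewrite !mulrA.
have -> : theta (fps_comp u f) n = \sum_(m < n.+1) f m * theta (u ^+ m) n.
  rewrite fcoef_theta -sumrMnl.
  by apply: eq_bigr => m _; rewrite mulrnAr.
(* The top term of the right-hand sum vanishes, because [theta u] has no constant term and [u ^+ n]
   has order at least [n]. *)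
have un0 : (u ^+ n * theta u) n = 0.
  rewrite fcoefM big_ord_recr /= subnn mulr0n mulr0 addr0.
  by apply: big1 => i _; rewrite -[u ^+ n]mulr1 fcoef_exp_small ?mul0r.
transitivity (\sum_(m < n) fps_deriv f m * (u ^+ m * theta u) n).
  rewrite big_ord_recl expr0 [theta 1](_ : _ = 0) ?fcoef0 ?mulr0 ?add0r.
    apply: eq_bigr => m _; rewrite lift0 theta_exp fcoefMn /=.
    by rewrite mulrnAr mulrnAl.
  by apply/fpsP => -[|k]; rewrite fcoef_theta ?mulr0n // mul0rn.
by rewrite big_ord_recr un0 mulr0 /= addr0.
Qed.

(* The geometric series in [1 - f]. *)
Definition fps_inv f : fps A := fps_comp (1 - f) (Fps (fun=> 1)).

Lemma fps_mulV f : f 0%N = 1 -> f * fps_inv f = 1.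
Proof.
move=> f0; have v0 : (1 - f) 0%N = 0 by rewrite fcoefB f0 subrr.
have geom : (1 - fpsX) * Fps (fun=> 1) = 1 :> fps A.
  apply/fpsP => n; rewrite mulrBl mul1r fcoefB fcoefXM fcoef1.
  by case: n => [|n] /=; rewrite ?subr0 ?subrr.
have cX : fps_comp (1 - f) (1 - fpsX) = f.
  by rewrite raddfB /= fps_comp1 fps_compX // subKr.
by rewrite -{1}cX -fps_compM // geom fps_comp1.
Qed.

End FpsRing.

Arguments fpsX {A}.

Section MapFps.
Variables (A B : comNzRingType) (phi : {rmorphism A -> B}).

Definition map_fps (f : fps A) : fps B := Fps (fun n => phi (f n)).

Fact map_fps_zmod : zmod_morphism map_fps.
Proof. by move=> f g; apply/fpsP => n /=; rewrite rmorphB. Qed.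
Fact map_fps_monoid : monoid_morphism map_fps.
Proof.
split=> [|f g]; apply/fpsP => n; first by rewrite /= rmorph_nat.
by rewrite fcoefM [LHS]rmorph_sum; apply: eq_bigr => i _; rewrite rmorphM.
Qed.
HB.instance Definition _ :=
  GRing.isZmodMorphism.Build (fps A) (fps B) map_fps map_fps_zmod.
HB.instance Definition _ :=
  GRing.isMonoidMorphism.Build (fps A) (fps B) map_fps map_fps_monoid.

Lemma map_fpsC a : map_fps (fpsC a) = fpsC (phi a).
Proof. by apply/fpsP => -[|n] //=; rewrite rmorph0. Qed.

Lemma map_theta f : map_fps (theta f) = theta (map_fps f).
Proof. by apply/fpsP => n; rewrite fcoef_theta /= rmorphMn. Qed.

Lemma map_scale a f : map_fps (fps_scale a f) = fps_scale (phi a) (map_fps f).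
Proof. by apply/fpsP => n /=; rewrite rmorphM rmorphXn. Qed.

End MapFps.

(** * Transfer matrices for Smirnov words *)

Section Walks.
Variables (A : comNzRingType) (q : A) (x : nat -> A) (N : nat).

Definition step_wt (c d : nat) : A := if (d < c)%N then q else 1.

Lemma step_wtxx c : step_wt c c = 1.
Proof. by rewrite /step_wt ltnn. Qed.

(* Weighted sum over the Smirnov words [w_1 ... w_n b] with [w_1 = c], where
   every descent contributes [q] and the last letter contributes no variable. *)
Fixpoint walk (n c b : nat) : A :=
  if n is n'.+1 then
    x c * \sum_(0 <= d < N | d != c) step_wt c d * walk n' d b
  else (c == b)%:R.

(** Here [b] is the last letter, [c] the first, and [step_wt b c] the closing step of the cycle. The
    words have length [n + 1]. *)
Definition cyclic_walk (n : nat) : A :=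
  \sum_(0 <= b < N) x b * \sum_(0 <= c < N) step_wt b c * walk n c b.

(** [X c] is x_c z, and [R a b] is the series R_a of the overview for words ending in [b]. The index
    [a] may also be [N], which exceeds every letter. *)
Let X c : fps A := fpsC (x c) * fpsX.
Let Q : fps A := fpsC q.
Let g c b : fps A := Fps (fun n => walk n c b).
Let R a b : fps A := \sum_(0 <= c < N) fpsC (step_wt a c) * g c b.

Lemma walk_series c b :
  g c b = (c == b)%:R
        + X c * \sum_(0 <= d < N | d != c) fpsC (step_wt c d) * g d b.
Proof.
apply/fpsP => n; rewrite fcoefD /X -mulrA fcoefCM fcoefXM; case: n => [|n].
  by rewrite mulr0 addr0 -(rmorph_nat (@fpsC A)).
rewrite -(rmorph_nat (@fpsC A)) /= add0r fcoef_sum; congr (_ * _).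
by apply: eq_bigr => d _; rewrite fcoefCM.
Qed.

(** The Smirnov condition leaves [d = a] out of the sum in [walk_series]; adding [X a * g a b]
    restores it. *)
Lemma walk_series_tail_gf a b : (a < N)%N -> (1 + X a) * g a b = (a ==
    b)%:R + X a * R a b.
Proof.
move=> aN; rewrite /R (bigD1_seq a) ?mem_index_iota ?iota_uniq //=.
rewrite step_wtxx rmorph1 mul1r mulrDl mul1r {1}walk_series.
by rewrite mulrDr -!addrA; congr (_ + _); rewrite addrC.
Qed.

(** Replacing [a] by [a + 1] turns only the step to the letter [a] into a descent, changing its
    weight from 1 to [q]. *)
Lemma tail_gfS a b : (a < N)%N -> R a.+1 b = R a b - (1 - Q) * g a b.
Proof.
move=> aN; rewrite /R !(bigD1_seq a) ?mem_index_iota ?iota_uniq //=.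
rewrite step_wtxx rmorph1 [step_wt a.+1 a]/step_wt ltnSn -/Q.
under eq_bigr => i ia do
  rewrite [step_wt _ _]/step_wt ltnS leq_eqVlt (negPf ia) -/(step_wt a i).
by ring.
Qed.

Lemma tail_gfS_mul a b : (a < N)%N ->
  (1 + X a) * R a.+1 b = (1 + Q * X a) * R a b - (1 - Q) * (a == b)%:R.
Proof.
move=> aN; rewrite tail_gfS // mulrBr mulrCA walk_series_tail_gf //; ring.
Qed.

Let P := \prod_(0 <= c < N) (1 + X c).
Let PQ := \prod_(0 <= c < N) (1 + Q * X c).

(** Iterates the recurrence from 0; its source term, located at [b], is not met as long as
    [a <= b]. *)
Lemma tail_gf_prefix a b : (a <= b)%N -> (b < N)%N ->
  \prod_(0 <= c < a) (1 + X c) * R a b =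
  \prod_(0 <= c < a) (1 + Q * X c) * R 0 b.
Proof.
move=> ab bN; elim: a ab => [|a IH] ab; first by rewrite !big_geq.
rewrite !big_nat_recr //= -mulrA tail_gfS_mul ?(ltn_trans ab) //
    (ltn_eqF ab) mulr0 subr0.
by rewrite mulrCA IH ?(ltnW ab) // mulrCA mulrA.
Qed.

(** The source term enters when [a] passes [b], and later steps multiply it by the factors
    [1 + Q * X c]. *)
Lemma tail_gf_suffix a b : (b < a)%N -> (a <= N)%N ->
  \prod_(0 <= c < a) (1 + X c) * R a b =
  \prod_(0 <= c < a) (1 + Q * X c) * R 0 b
  - (1 - Q) * (\prod_(0 <= c < b) (1 + X c) * \prod_(b.+1 <=
      c < a) (1 + Q * X c)).
Proof.
elim: a => // a IH; rewrite ltnS => ba aN.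
rewrite !(@big_nat_recr _ _ _ a 0) //= -mulrA tail_gfS_mul //.
move: ba; rewrite leq_eqVlt => /predU1P[ba|ba].
  subst a; rewrite eqxx (@big_geq _ _ _ b.+1) //
      mulr1 mulr1 mulrBr mulrCA tail_gf_prefix //.
  by ring.
rewrite (gtn_eqF ba) mulr0 subr0 mulrCA IH ?(ltnW aN) //.
by rewrite (@big_nat_recr _ _ _ a b.+1) //=; ring.
Qed.

Lemma tail_gf_diag b : (b < N)%N ->
  (PQ - Q * P) * R b b =
  (1 - Q) * (\prod_(0 <= c < b) (1 + Q * X c) * \prod_(b.+1 <=
      c < N) (1 + Q * X c)).
Proof.
move=> bN; have := tail_gf_suffix bN (leqnn N); rewrite -/P -/PQ.
(* From [N] every step is a descent, from 0 none is; this closes the recurrence into a linear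
   equation for [R 0 b]. *)
have -> : R N b = Q * R 0 b.
  rewrite /R mulr_sumr; apply: eq_big_nat => c /andP[_ cN].
  by rewrite mulrA -rmorphM /= /step_wt cN ltn0 mulr1.
move=> E; have E0 : (PQ - Q * P) * R 0 b =
    (1 - Q) * (\prod_(0 <= c < b) (1 + X c) * \prod_(b.+1 <=
        c < N) (1 + Q * X c)).
  have -> : (PQ - Q * P) * R 0 b = PQ * R 0 b - P * (Q * R 0 b) by ring.
  by rewrite E; ring.
(* The prefix product, which relates [R b b] to [R 0 b], has constant term 1 and can be
   cancelled. *)
apply: (@fps_mulI _ (\prod_(0 <= c < b) (1 + X c))).
  elim: (b) => [|k IH]; first by rewrite big_geq.
  rewrite (@big_nat_recr (fps A)) // [LHS]fcoefM0 IH mul1r fcoefD /X fcoefM0.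
  by rewrite mulr0 addr0.
by rewrite mulrCA tail_gf_prefix // mulrCA E0; ring.
Qed.

Lemma cyclic_walk_series :
  (PQ - Q * P) * (fpsX * Fps cyclic_walk) =
  (1 - Q) * \sum_(0 <= b < N) \prod_(0 <= c < b) (1 + Q * X c) * X b
              * \prod_(b.+1 <= c < N) (1 + Q * X c).
Proof.
have -> : fpsX * Fps cyclic_walk = \sum_(0 <= b < N) X b * R b b.
  under eq_bigr do rewrite /X mulrAC mulrC.
  rewrite -mulr_sumr; congr (_ * _); apply/fpsP => n.
  rewrite fcoef_sum; apply: eq_bigr => b _; rewrite fcoefCM; congr (_ * _).
  by rewrite fcoef_sum; apply: eq_bigr => c _; rewrite fcoefCM.
rewrite !mulr_sumr; apply: eq_big_nat => b /andP[_ bN].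
by rewrite mulrCA tail_gf_diag //; ring.
Qed.

End Walks.

(** * Descents and weighted sums over Smirnov words *)

Lemma des_cons2 a b w : des [:: a, b & w] = ((b < a) + des (b :: w))%N.
Proof.
rewrite /des /= -[1%N]/(1 + 0)%N iotaDl count_map; congr addn.
Qed.

Lemma cdes_cons a w : cdes (a :: w) = (des (a :: w) + (a < last a w))%N.
Proof.
rewrite /cdes /des [size _]/= -addn1 iotaD count_cat /= addn0 addn1; congr addn.
  apply: eq_in_count => i; rewrite mem_iota /= => i_w.
  by rewrite modn_small.
rewrite add0n modnn.
by rewrite -[nth _ _ (size w)]/(nth 0%N (a :: w) (size (a :: w)).-1) nth_last.
Qed.

Lemma big_tuple_cons (V : nmodType) (T : finType) n
    (P : pred (seq T)) (F : seq T -> V) :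
  \sum_(w : n.+1.-tuple T | P w) F w =
  \sum_(a : T) \sum_(w : n.-tuple T | P (a :: w)) F (a :: w).
Proof.
rewrite pair_big_dep /=.
rewrite (reindex (fun p : T * n.-tuple T => [tuple of p.1 :: p.2])) //=.
exists (fun w : n.+1.-tuple T => (thead w,
    [tuple of behead w])) => [[a w] _|w _] /=.
  by congr pair; apply: val_inj.
by rewrite -tuple_eta.
Qed.

Section Words.
Variables (K : comNzRingType) (q : K) (N : nat).

(** Extended by 0 to all of [nat], since [walk] takes natural numbers as letters. *)
Definition mvar (c : nat) : {mpoly K[N]} :=
  if insub c is Some i then 'X_i else 0.

Lemma mvarE (i : 'I_N) : mvar i = 'X_i.
Proof. by rewrite /mvar valK. Qed.

Lemma step_wtE (c d : nat) :
  step_wt (q%:A : {mpoly K[N]}) c d = (q ^+ (d < c)%N)%:A.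
Proof. by rewrite /step_wt; case: ifP => _; rewrite ?expr1 ?expr0 ?scale1r. Qed.

Lemma walk_words n (c b : 'I_N) :
  walk q%:A mvar N n c b =
  \sum_(w : n.-tuple 'I_N | smirnov (map val (c :: w)) && (last c w == b))
    q ^+ des (map val (c :: w)) *: \prod_(i <- belast c w) 'X_i.
Proof.
elim: n c => [|n IH] c.
  rewrite big_mkcond (big_pred1 [tuple]) => [|w]; last first.
    by rewrite [w]tuple0; apply/esym/eqP.
  by rewrite /= val_eqE; case: eqP => _; rewrite ?big_nil // expr0 scale1r.
rewrite [LHS]/= mvarE big_mkord mulr_sumr.
rewrite (@big_tuple_cons _ _ _ (fun w => smirnov (map val (c ::
    w)) && (last c w == b))
  (fun w => q ^+ des (map val (c :: w)) *: \prod_(i <- belast c w) 'X_i)).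
rewrite big_mkcond /=; apply: eq_bigr => d _; rewrite eq_sym.
have [->|dc] := eqVneq c d; first by rewrite eqxx big1.
rewrite val_eqE dc IH !mulr_sumr; apply: eq_bigr => w _.
rewrite des_cons2 step_wtE big_cons mulr_algl scalerA -exprD.
by rewrite -scalerAr.
Qed.

Lemma cyclic_walk_words n :
  cyclic_walk q%:A mvar N n =
  \sum_(w : n.+1.-tuple 'I_N | smirnov (map val w))
    q ^+ cdes (map val w) *: \prod_(i <- w) 'X_i.
Proof.
rewrite (@big_tuple_cons _ _ _ (fun w => smirnov (map val w))
  (fun w => q ^+ cdes (map val w) *: \prod_(i <- w) 'X_i)) /=.
rewrite /cyclic_walk big_mkord.
under [LHS]eq_bigr => b _ do rewrite big_mkord mulr_sumr.
rewrite exchange_big /=; apply: eq_bigr => c _.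
(* Sorting the words by their last letter fixes the closing comparison in [cdes_cons]. *)
rewrite [RHS](partition_big (fun w : n.-tuple 'I_N => last c w) xpredT) //=.
apply: eq_bigr => b _; rewrite walk_words !mulr_sumr.
apply: eq_bigr => w /andP[_ /eqP wb].
rewrite (cdes_cons c) -map_cons last_map wb addnC exprD mvarE step_wtE.
rewrite mulr_algl !scalerA mulrC -scalerAl; congr (_ *: _).
by rewrite lastI big_rcons wb.
Qed.
End Words.

(** * Elementary and complete symmetric functions *)

Lemma fcoefX_exp (A : comNzRingType) m n : (fpsX ^+ m : fps A) n = (n == m)%:R.
Proof.
elim: m n => [|m IH] n //; rewrite exprS fcoefXM.
by case: n => [|n] //; rewrite IH.
Qed.

Lemma scale_linear (A : comNzRingType) (q a : A) :
  fps_scale q (1 + fpsC a * fpsX) = 1 + fpsC q * (fpsC a * fpsX).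
Proof.
rewrite rmorphD rmorph1; congr (_ + _); apply/fpsP => n.
rewrite fcoef_scale !fcoefCM; case: n => [|[|n]] /=; last by rewrite !mulr0.
  by rewrite !mulr0.
by rewrite expr1.
Qed.

(** Expanding the product selects the set [h] of factors that contribute x_c z, which gives E(z) in
    [N] variables. *)
Lemma prod_mesym (K : comNzRingType) N :
  \prod_(0 <= c < N) (1 + fpsC (@mvar K N c) * fpsX) = Fps (mesym N K).
Proof.
rewrite big_mkord; under eq_bigr do rewrite mvarE.
under eq_bigr do rewrite addrC.
rewrite bigA_distr; apply/fpsP => n.
rewrite fcoef_sum /= /mesym [RHS]big_mkcond; apply: eq_bigr => /= h _.
have -> : \prod_i (if i \in h then fpsC 'X_i * fpsX else 1) =
    fpsC (\prod_(i in h) 'X_i : {mpoly K[N]}) * fpsX ^+ #|h|.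
  by rewrite -big_mkcond big_split /= -rmorph_prod prodr_const.
rewrite fcoefCM fcoefX_exp.
by rewrite [n == _]eq_sym; case: eqP => _; rewrite ?mulr1 ?mulr0.
Qed.

(** * Newton's identity for complete symmetric functions *)

Section Newton.
Variables (K : comNzRingType).

Lemma mcoeff_Xn_mhsym N (i : 'I_N) k n (m : 'X_{1..N}) : (k <= n)%N ->
  ('X_i ^+ k * mhsym K N (n - k))@_m = ((k <= m i)%N && (mdeg m == n))%:R.
Proof.
move=> kn; rewrite mpolyXn mulrC; have [kmi|mik] := leqP k (m i).
  have mE : m = (U_(i) *+ k + (m - U_(i) *+ k))%MM.
    apply/mnmP => j; rewrite mnmDE mnmBE mulmnE mnm1E.
    by case: eqP => [<-|_]; rewrite ?mul1n ?subnKC // mul0n subn0.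
  rewrite {1}mE mcoeffMX mcoeff_mhsym [in RHS]mE mdegD mdegMn mdeg1 mul1n /=.
  by rewrite -(eqn_add2l k) subnKC.
rewrite /mhsym mulr_suml raddf_sum big1 // => m' _ /=.
rewrite -mpolyXD mcoeffX; case: eqP => // E.
by move: mik; rewrite -E mnmDE mulmnE mnm1E eqxx mul1n ltnNge leq_addl.
Qed.

Definition sf_H : fps (symfun K) := Fps sf_h.
(** The constant term is 0, whereas [sf_p 0] is 1 by convention. *)
Definition sf_P : fps (symfun K) := Fps (fun k => if k ==
    0%N then 0 else sf_p k).

(** A monomial [m] of degree [n] occurs in p_k h_(n-k) once for each [i] with [k <= m i]; summing
    over [k >= 1] counts it [mdeg m = n] times. *)
Lemma theta_sf_H : theta sf_H = sf_P * sf_H.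
Proof.
apply/fpsP => n; rewrite fcoef_theta fcoefM big_ord_recl /= mul0r add0r.
apply: symfunP => N; rewrite -[LHS]/(sf_restr N _) -[RHS]/(sf_restr N _)
    raddfMn raddf_sum.
apply/mpolyP => m; rewrite mcoeffMn [_@_m]mcoeff_mhsym raddf_sum /=.
transitivity (\sum_(j < n) \sum_(i < N) ((j < m i)%N && (mdeg m == n))%:R : K);
    last first.
  apply: eq_bigr => j _; rewrite mulr_suml raddf_sum.
  by apply: eq_bigr => i _; rewrite -[bump 0 j]/(j.+1) /= mcoeff_Xn_mhsym.
have [mn|_] := eqVneq (mdeg m) n; last first.
  by rewrite mul0rn big1 // => j _; rewrite big1 // => i _; rewrite andbF.
rewrite exchange_big /= -[LHS]/(n%:R) -{1}mn mdegE natr_sum.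
apply: eq_bigr => i _; under eq_bigr do rewrite andbT.
rewrite -natr_sum; congr (_%:R).
have mi_n : (m i <= n)%N by rewrite -mn mdegE (bigD1 i) //= leq_addr.
rewrite -[RHS]big_mkcond -(big_ord_widen _ (fun=> 1%N) mi_n).
by rewrite sum1_card card_ord.
Qed.

End Newton.

(** As [p] has no constant term, the equation expresses [n] times coefficient [n] of the difference
    by earlier ones; the first hypothesis allows division by [n]. *)
Lemma theta_ode_unique (A : comNzRingType) (p f g : fps A) :
  (forall (a : A) n, a *+ n.+1 = 0 -> a = 0) -> p 0%N = 0 ->
  theta f = p * f -> theta g = p * g -> f 0%N = g 0%N -> f = g.
Proof.
move=> A0 p0 fE gE fg0; apply/eqP; rewrite -subr_eq0; apply/eqP.
have {fg0} : (f - g) 0%N = 0 by rewrite fcoefB fg0 subrr.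
have {fE gE} : theta (f - g) = p * (f - g) by rewrite raddfB /= fE gE mulrBr.
move: (f - g) => h hE h0; apply/fpsP => n; rewrite fcoef0.
elim/ltn_ind: n => -[//|n] IH; apply: (A0 _ n).
rewrite -fcoef_theta hE fcoefM big_ord_recl p0 mul0r add0r big1 // => i _.
by rewrite IH ?mulr0 // lift0 subSS ltnS leq_subr.
Qed.

(** * Eulerian polynomials *)

Section Eulerian.
Variable K : comNzRingType.

Definition insert_at (M i : nat) (v : seq nat) : seq nat :=
  take i v ++ M :: drop i v.

(** Placing the maximum [M] inside a descent or at the end keeps the number of descents; any other
    position after the first letter adds one. *)
Lemma sum_des_insert_inner M a v : all (fun k => k < M)%N (a :: v) ->
  \sum_(i < (size v).+1) 'X^(des (insert_at M i.+1 (a :: v))) =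
  (des (a :: v)).+1%:R * 'X^(des (a :: v))
  + ((size v)%:R - (des (a :: v))%:R) * 'X^((des (a :: v)).+1) :> {poly K}.
Proof.
elim: v a => [|b v IH] a /= /andP[aM vM].
  rewrite big_ord1 /insert_at /= des_cons2 ltnNge (ltnW aM).
  by rewrite subrr mul0r addr0 mul1r.
have /andP[bM _] := vM.
have ins1 : insert_at M 1 [:: a, b & v] = [:: a, M, b & v] by [].
have insS (i : nat) : insert_at M i.+2 [:: a, b & v] =
  [:: a, b & insert_at M i v] by [].
rewrite big_ord_recl ins1 !des_cons2 (ltnNge M) (ltnW aM) bM.
under eq_bigr => i _ do rewrite lift0 insS des_cons2 exprD.
rewrite -mulr_sumr (IH _ vM); move: (des _) => d.
case: (b < a)%N; rewrite ?add0n ?add1n /= ?expr1 ?expr0 ?mul1r.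
  by rewrite !exprS -!natr1; ring.
by rewrite !exprS -!natr1; ring.
Qed.

Lemma sum_des_insert M a v : all (fun k => k < M)%N (a :: v) ->
  \sum_(i < (size v).+2) 'X^(des (insert_at M i (a :: v))) =
  (des (a :: v)).+1%:R * 'X^(des (a :: v))
  + ((size v).+1%:R - (des (a :: v))%:R) * 'X^((des (a :: v)).+1) :> {poly K}.
Proof.
move=> avM; rewrite big_ord_recl sum_des_insert_inner // /insert_at /=.
have /andP[aM _] := avM.
by rewrite des_cons2 aM add1n -!natr1; ring.
Qed.

Definition perm_word m (s : 'S_m) : seq nat := [seq val (s i) | i <- enum 'I_m].

Definition eul m : {poly K} := \sum_(s : 'S_m) 'X^(des (perm_word s)).

Lemma size_perm_word m (s : 'S_m) : size (perm_word s) = m.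
Proof. by rewrite size_map size_enum_ord. Qed.

Lemma nth_perm_word m (s : 'S_m) (i : 'I_m) : nth 0%N (perm_word s) i = s i.
Proof. by rewrite (nth_map i) ?size_enum_ord // nth_ord_enum. Qed.

Lemma perm_word_lift m (i : 'I_m.+1) (s : 'S_m) :
  perm_word (lift_perm i ord_max s) = insert_at m i (perm_word s).
Proof.
have i_m : (i <= m)%N by rewrite -ltnS.
have sz : size (take i (perm_word s)) = i by rewrite size_takel ?size_perm_word.
apply: (@eq_from_nth _ 0%N).
  by rewrite size_cat sz /= size_drop !size_perm_word addnS subnKC.
move=> k; rewrite size_perm_word => km; rewrite -[k]/(val (Ordinal km)).
rewrite nth_perm_word; case: (unliftP i (Ordinal km)) => [j ->|->].
  rewrite lift_perm_lift /insert_at nth_cat sz /= /bump.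
  rewrite [(m <= s j)%N]leqNgt ltn_ord add0n; have [ij|ji] := leqP i j.
    rewrite add1n ltnNge (leqW ij) /= subSn //= nth_drop subnKC //.
    by rewrite nth_perm_word.
  by rewrite add0n ji nth_take // nth_perm_word.
by rewrite lift_perm_id /insert_at nth_cat sz ltnn subnn.
Qed.

(** The position of the maximum and the remaining word determine the permutation; surjectivity
    follows by cardinality. *)
Lemma lift_perm_max_bij m :
  bijective (fun p : 'I_m.+1 * 'S_m => lift_perm p.1 ord_max p.2).
Proof.
apply: inj_card_bij; last by rewrite card_prod card_ord !card_Sn factS.
move=> [i s] [j r] /= E.
have ij : i = j.
  by apply: (@perm_inj _ (lift_perm i ord_max s)); rewrite {2}E !lift_perm_id.
subst j; congr pair; apply/permP => k; apply: (@lift_inj _ ord_max).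
by rewrite -!(lift_perm_lift i) E.
Qed.

Lemma eul1 : eul 1 = 1.
Proof.
rewrite /eul (big_pred1 1%g) => [|s]; last by apply/esym/eqP/permP => i;
    rewrite !ord1.
by rewrite /des size_perm_word.
Qed.

Lemma eulS m : eul m.+2 = \sum_(s : 'S_m.+1)
   ((des (perm_word s)).+1%:R * 'X^(des (perm_word s))
     + (m.+1%:R - (des (perm_word s))%:R) * 'X^((des (perm_word s)).+1)).
Proof.
rewrite /eul (reindex _ (onW_bij _ (lift_perm_max_bij m.+1))) /=.
rewrite -(pair_bigA _ (fun i s => 'X^(des (perm_word (lift_perm i ord_max
    s))))) /=.
rewrite exchange_big; apply: eq_bigr => s _.
under eq_bigr do rewrite perm_word_lift.
have sz := size_perm_word s.
have lt_m : all (fun k => k < m.+1)%N (perm_word s).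
  by apply/allP => k /mapP[i _ ->]; apply: ltn_ord.
move: (perm_word s) sz lt_m => [//|a v] [sz] lt_m.
by have := sum_des_insert lt_m; rewrite sz.
Qed.

(* [tA_m(t)], with value 1 at [m = 0]. *)
Definition eulX m : {poly K} := if m == 0%N then 1 else 'X * eul m.

(** The insertion recurrence [eulS] in differential form; multiplying A_m by t makes it hold from
    [m = 0] on. *)
Lemma eulXS m :
  eulX m.+1 = m.+1%:R * 'X * eulX m + 'X * (1 - 'X) * (eulX m)^`().
Proof.
case: m => [|m].
  by rewrite /eulX /= eul1 derivC mulr0 addr0 !mulr1 mul1r.
rewrite /eulX /= eulS /eul !mulr_sumr raddf_sum mulr_sumr -big_split /=.
apply: eq_bigr => s _; move: (des _) => d.
rewrite -exprS derivXn /= -mulr_natl !exprS -!natr1; ring.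
Qed.

(** The coefficient of u^m / m! in the product of exp((1 - t) u) and sum_j tA_j(t) u^j / j!, with
    ['X] for t. *)
Let S m : {poly K} := \sum_(j < m.+1) 'C(m,
    j)%:R * (1 - 'X) ^+ (m - j) * eulX j.

(** Pascal's rule; on generating functions it is the Leibniz rule for d/du. *)
Lemma eulX_binomialS m : S m.+1 =
  (1 - 'X) * S m + \sum_(j < m.+1) 'C(m,
      j)%:R * (1 - 'X) ^+ (m - j) * eulX j.+1.
Proof.
have -> : (1 - 'X) * S m =
    \sum_(j < m.+2) 'C(m, j)%:R * (1 - 'X) ^+ (m.+1 - j) * eulX j.
  rewrite [RHS]big_ord_recr /= bin_small // !mul0r addr0 mulr_sumr.
  apply: eq_bigr => j _; rewrite subSn -1?ltnS // exprS; ring.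
rewrite /S big_ord_recl [in RHS]big_ord_recl -addrA -big_split /= !bin0.
congr (_ + _); apply: eq_bigr => j _.
rewrite -[bump 0 j]/(j.+1) subSS binS natrD.
by rewrite !mulrDl.
Qed.

Lemma deriv_exp_1subX k :
  (1 - 'X) * ((1 - 'X) ^+ k)^`() = - k%:R * (1 - 'X) ^+ k :> {poly K}.
Proof.
case: k => [|k]; first by rewrite expr0 derivC mulr0 oppr0 mul0r.
rewrite deriv_exp derivB derivC derivX sub0r -mulr_natl exprS /=; ring.
Qed.

(** On generating functions this says that (1 - t exp((1 - t) u)) times sum_m tA_m(t) u^m / m!
    equals 1 - t. *)
Lemma eulX_binomial m :
  'X * (\sum_(j < m.+1) 'C(m, j)%:R * (1 - 'X) ^+ (m - j) * eulX j) =
  eulX m - (m == 0%N)%:R * (1 - 'X).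
Proof.
rewrite -/(S m); elim: m => [|m IH].
  by rewrite /S big_ord1 bin0 subnn expr0 !mul1r mulr1 /eulX /= subKr.
(* Differentiating the power produces [m - j], the recurrence for [eulX] produces [j + 1]; their
   total [m + 1] does not depend on [j]. *)
have dS : 'X * (1 - 'X) * (S m)^`() =
    \sum_(j < m.+1) 'C(m, j)%:R * (1 - 'X) ^+ (m - j) * eulX j.+1
    - m.+1%:R * 'X * S m.
  rewrite raddf_sum !mulr_sumr -sumrB; apply: eq_bigr => j _ /=.
  have jm : (j <= m)%N by rewrite -ltnS.
  rewrite eulXS -(polyC_natr K 'C(m, j)) !derivM derivC.
  have := deriv_exp_1subX (m - j).
  move: ((1 - 'X) ^+ (m - j)) => D; move: D^`() => D' DE.
  have -> : m.+1%:R = (m - j)%:R + j.+1%:R :> {poly K}.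
    by rewrite -natrD addnS subnK.
  move: (eulX j)^`() => B'; move: (eulX j) ('C(m, j)%:R)%:P => B c.
  transitivity ('X * c * B * ((1 - 'X) * D') + 'X * (1 - 'X) * c * D * B');
      first by ring.
  by rewrite DE; ring.
have E : eulX m = 'X * S m + (m == 0%N)%:R * (1 - 'X) by rewrite IH subrK.
rewrite eulXS {2}E mul0r subr0 eulX_binomialS E.
rewrite derivD derivM derivX [(_ * (1 - 'X))^`()](_ : _ = - (m == 0%N)%:R);
    last first.
  by rewrite -polyC_natr derivM derivC derivB derivC derivX; ring.
have -> : \sum_(j < m.+1) 'C(m, j)%:R * (1 - 'X) ^+ (m - j) * eulX j.+1 =
    'X * (1 - 'X) * (S m)^`() + m.+1%:R * 'X * S m by rewrite dS subrK.
have d0 : m.+1%:R * (m == 0%N)%:R = (m == 0%N)%:R :> {poly K}.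
  by case: (m) => [|k]; rewrite ?mulr1 ?mulr0.
apply: esym; transitivity ('X * ((1 - 'X) * S m + ('X * (1 - 'X) * (S m)^`() +
    m.+1%:R * 'X * S m))
    + 'X * (1 - 'X) * (m.+1%:R * (m == 0%N)%:R - (m == 0%N)%:R)); first by ring.
by rewrite d0 subrr mulr0 addr0.
Qed.
End Eulerian.

(** * Removing a part from a partition *)

Lemma geq_trans : transitive geq.
Proof. by move=> b a c /= ba cb; apply: leq_trans cb ba. Qed.
Lemma geq_anti : antisymmetric geq.
Proof. by move=> a b; rewrite /= andbC => /anti_leq. Qed.
Lemma geq_total : total geq.
Proof. by move=> a b; apply: leq_total. Qed.

Lemma mem_leq_sumn i s : i \in s -> (i <= sumn s)%N.
Proof. by move=> si; rewrite sumnE (big_rem i) //= leq_addr. Qed.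

Lemma zpart_widen s M : (sumn s < M)%N ->
  zpart s = (\prod_(1 <= i < M) (i ^ count_mem i s * (count_mem i s)`!))%N.
Proof.
move=> sM; rewrite (big_cat_nat (n := (sumn s).+1)) //=.
rewrite [X in (_ * X)%N]big1_seq ?muln1 // => i;
    rewrite mem_index_iota => /andP[_ /andP[si _]].
rewrite (count_memPn _) //; apply/negP => /mem_leq_sumn.
by rewrite leqNgt si.
Qed.

Lemma zpart_perm s1 s2 : perm_eq s1 s2 -> zpart s1 = zpart s2.
Proof.
move=> s12; have sum12 : sumn s1 = sumn s2 by rewrite !sumnE (perm_big _ s12).
rewrite /zpart sum12; apply: eq_bigr => i _.
by move/seq.permP: s12 => ->.
Qed.

(** The multiplicity of [k] rises by one, which adds a factor [k] to the power and the new
    multiplicity to the factorial. *)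
Lemma zpart_cons k s : (0 < k)%N ->
  zpart (k :: s) = (k * (count_mem k s).+1 * zpart s)%N.
Proof.
move=> k0; rewrite (@zpart_widen (k :: s) (k + sumn s).+1) //.
rewrite (@zpart_widen s (k + sumn s).+1) ?ltnS ?leq_addl //.
rewrite !(bigD1_seq k) ?iota_uniq ?mem_index_iota ?k0 ?ltnS ?leq_addr //=.
rewrite eqxx add1n expnS factS [RHS]mulnA; congr (_ * _)%N; first by ring.
by apply: eq_bigr => i ik; rewrite [k == i]eq_sym (negPf ik).
Qed.

Lemma intpartP n (la : intpart n) : is_intpart n la.
Proof. by case: la. Qed.

Fact ones_intpart m : is_intpart m (nseq m 1%N).
Proof.
rewrite /is_intpart sumn_nseq mul1n eqxx andbT mem_nseq andbF andbT.
by elim: m => [|[|m] IH].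
Qed.

Definition ones m : intpart m := IntPart (ones_intpart m).

Section PartInsertion.
Variables (n k : nat).
Hypothesis kn : (0 < k <= n)%N.

Definition ins_seq (s : seq nat) : seq nat := sort geq (k :: s).

Fact ins_intpart (mu : intpart (n - k)) : is_intpart n (ins_seq mu).
Proof.
have /and3P[_ mu0 /eqP mus] := intpartP mu; have /andP[k0 k_n] := kn.
rewrite /is_intpart sort_sorted ?mem_sort ?inE; last exact: geq_total.
rewrite negb_or mu0 eq_sym -lt0n k0 /=.
rewrite sumnE (perm_big (k :: mu)) ?perm_sort // -sumnE /= mus.
by rewrite subnKC.
Qed.

Definition ins (mu : intpart (n - k)) : intpart n := IntPart (ins_intpart mu).
Definition del (la : intpart n) : intpart (n - k) := insubd (ones _) (rem k la).

Lemma perm_ins mu : perm_eq (ins mu) (k :: mu).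
Proof. by rewrite perm_sort. Qed.

Lemma mem_ins mu : k \in (ins mu : seq nat).
Proof. by rewrite mem_sort mem_head. Qed.

Lemma rem_is_intpart (la : intpart n) : k \in (la : seq nat) ->
  is_intpart (n - k) (rem k la).
Proof.
have /and3P[la_s la0 /eqP lan] := intpartP la => kla.
apply/and3P; split.
- exact: (subseq_sorted geq_trans (rem_subseq k la)).
- by apply: contra la0; apply: mem_rem.
- by apply/eqP; rewrite -[RHS](congr1 (subn^~ k) lan) /=
    !sumnE [in RHS](big_rem k) //= addKn.
Qed.

Lemma delE (la : intpart n) : k \in (la : seq nat) -> del la =
    rem k la :> seq nat.
Proof. by move=> kla; rewrite val_insubd rem_is_intpart. Qed.

Lemma delK (la : intpart n) : k \in (la : seq nat) -> ins (del la) = la.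
Proof.
move=> kla; apply: val_inj => /=; apply: (sorted_eq geq_trans geq_anti).
- exact/sort_sorted/geq_total.
- by have /and3P[] := intpartP la.
- by rewrite perm_sort delE // perm_sym perm_to_rem.
Qed.

Lemma rem_ins mu : rem k (ins mu) = mu :> seq nat.
Proof.
apply: (sorted_eq geq_trans geq_anti).
- apply: (subseq_sorted geq_trans (rem_subseq k _)).
  by have /and3P[] := intpartP (ins mu).
- by have /and3P[] := intpartP mu.
- rewrite -(perm_cons k); apply: perm_trans (perm_ins mu).
  by rewrite perm_sym; apply: perm_to_rem (mem_ins mu).
Qed.

Lemma insK mu : del (ins mu) = mu.
Proof. by apply: val_inj; rewrite /= delE ?mem_ins // rem_ins. Qed.

End PartInsertion.

Lemma sum_parts (A : nzSemiRingType) n (la : intpart n) (G : nat -> A) :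
  \sum_(i < size la) G (nth 0%N la i) =
  \sum_(k < n) (count_mem k.+1 la)%:R * G k.+1.
Proof.
rewrite -(big_mkord xpredT (fun i => G (nth 0%N la i))) -(big_nth 0%N xpredT G).
have /and3P[_ la0 /eqP lan] := intpartP la.
have : all (fun i => 0 < i <= n)%N la.
  apply/allP => i ila; have := mem_leq_sumn ila; rewrite lan => ->.
  rewrite andbT lt0n.
  by apply: contraNneq la0 => <-.
elim: (la : seq nat) => [|a s IH] /=.
  by move=> _; rewrite big_nil big1 // => k _; rewrite mul0r.
case/andP=> /andP[a0 an] /IH {}IH; rewrite big_cons IH.
under [RHS]eq_bigr do rewrite natrD mulrDl.
rewrite big_split /=; congr (_ + _).
have a_n : (a.-1 < n)%N by rewrite prednK.
rewrite (bigD1 (Ordinal a_n)) //= prednK // eqxx mul1r big1 ?addr0 // => i ia.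
case: eqP => [ai|_]; last by rewrite mul0r.
by case/eqP: ia; apply: val_inj; rewrite /= ai.
Qed.

Section PartSum.
Variables (K : fieldType) (A : comAlgType K).
Hypothesis K0 : forall n, (n.+1%:R : K) != 0.

(** Counts partitions with a marked part. A part k of multiplicity m can be marked in m ways, and
    removing it divides [zpart] by k m, so m cancels and 1/k remains. *)
Lemma sum_intpart_part n (f : nat -> A) (F : seq nat -> A) :
  \sum_(la : intpart n) (zpart la)%:R^-1 *:
     \sum_(i < size la) f (nth 0%N la i) * F (rem (nth 0%N la i) la) =
  \sum_(k < n) k.+1%:R^-1 *: (f k.+1 *
     \sum_(mu : intpart (n - k.+1)) (zpart mu)%:R^-1 *: F mu).
Proof.
under eq_bigr => la _ do
  rewrite (sum_parts la (fun p => f p * F (rem p la))) scaler_sumr.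
rewrite exchange_big /=; apply: eq_bigr => k _.
have kn : (0 < k.+1 <= n)%N by rewrite /= ltn_ord.
rewrite (bigID (fun la : intpart n => k.+1 \in (la : seq nat))) /=.
rewrite [X in _ + X]big1 ?addr0 => [|la kla]; last first.
  by rewrite (count_memPn kla) mul0r scaler0.
(* Partitions of [n] with a part [k.+1] correspond to partitions of [n - k.+1], by deleting and
   inserting that part. *)
rewrite (reindex_onto (ins kn) (@del n k.+1)); last exact: delK.
rewrite mulr_sumr scaler_sumr; apply: eq_big => [mu|mu _].
  by rewrite mem_ins insK eqxx.
rewrite rem_ins (zpart_perm (perm_ins kn mu)) (seq.permP (perm_ins kn mu)).
rewrite zpart_cons //= eqxx add1n !natrM !invfM mulr_natl -scaler_nat.
rewrite -scalerAr !scalerA; congr (_ *: _).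
by rewrite mulrAC mulfVK.
Qed.
End PartSum.

(** * The generating function of the sums over partitions *)

Lemma t_neq0 : t != 0.
Proof. by rewrite tofrac_eq0 polyX_eq0. Qed.

Lemma onem_t_neq0 : 1 - t != 0.
Proof.
rewrite -[1](rmorph1 (@tofrac {poly rat})) -rmorphB tofrac_eq0 subr_eq0 /=.
apply/eqP => /(congr1 (fun p : {poly rat} => p`_0)).
by rewrite /= coef1 coefX /= => /eqP; rewrite oner_eq0.
Qed.

Lemma natr_Qt_neq0 n : (n.+1%:R : Qt) != 0.
Proof.
rewrite -(rmorph_nat (@tofrac {poly rat})) tofrac_eq0 -polyC_natr polyC_eq0.
by rewrite Num.Theory.pnatr_eq0.
Qed.

(** Moves polynomial identities to Q(t); the factor [t] matches the convention A_0 = 1/t with the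
    value 1 of [eulX] at 0. *)
Lemma eulerianE m : t * eulerian m = tofrac (eulX rat m).
Proof.
rewrite /eulerian /eulX; case: eqP => [_|m0].
  by rewrite divff ?t_neq0 // rmorph1.
rewrite rmorphM /eul rmorph_sum; congr (_ * _).
by apply: eq_bigr => s _; rewrite rmorphXn.
Qed.

Lemma eulerian_binomial m :
  t * (\sum_(j < m.+1) 'C(m, j)%:R * (1 - t) ^+ (m - j) * eulerian j) =
  eulerian m - (m == 0%N)%:R * ((1 - t) / t).
Proof.
apply: (mulfI t_neq0); rewrite mulrBr eulerianE.
have -> : t * ((m == 0%N)%:R * ((1 - t) / t)) = (m == 0%N)%:R * (1 - t).
  by rewrite mulrCA [t * _]mulrC mulfVK ?t_neq0.
have := congr1 (@tofrac {poly rat}) (eulX_binomial rat m).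
rewrite rmorphM rmorphB rmorphM rmorph_nat rmorphB rmorph1 -/t => <-.
congr (_ * _); rewrite mulr_sumr rmorph_sum; apply: eq_bigr => j _ /=.
rewrite !rmorphM rmorph_nat rmorphXn rmorphB rmorph1 /= -/t -eulerianE.
by rewrite mulrCA.
Qed.

Local Notation LamQ := (symfun Qt).

Definition cst : Qt -> fps LamQ := @fpsC LamQ \o GRing.in_alg LamQ.
HB.instance Definition _ := GRing.RMorphism.on cst.

Lemma fcoef_cstM c (f : fps LamQ) n : (cst c * f) n = c *: f n.
Proof. by rewrite fcoefCM /= mulr_algl. Qed.

Definition eul_egf : fps Qt := Fps (fun m => eulerian m / m`!%:R).
Definition exp_egf : fps Qt := Fps (fun m => (1 - t) ^+ m / m`!%:R).

Lemma fact_Qt_neq0 m : (m`!%:R : Qt) != 0.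
Proof. by rewrite -(prednK (fact_gt0 m)) natr_Qt_neq0. Qed.

Lemma mulf_div_cross (F : fieldType) (a b c d e : F) :
  a != 0 -> b != 0 -> c != 0 -> (e / a) * (d / b) = c * d * e / (c * (a * b)).
Proof. by move=> a0 b0 c0; field; rewrite a0 b0 c0. Qed.

(** Coefficient [n] is [eulerian_binomial] divided by n!, because C(n,j) / n! = 1 / (j! (n-j)!). *)
Lemma eul_egfE : (1 - fpsC t * exp_egf) * eul_egf = fpsC ((1 - t) / t).
Proof.
apply/fpsP => n; rewrite mulrBl mul1r -mulrA fcoefB fcoefCM.
have -> : (exp_egf * eul_egf) n =
    (\sum_(j < n.+1) 'C(n, j)%:R * (1 - t) ^+ (n - j) * eulerian j) / n`!%:R.
  rewrite mulrC fcoefM mulr_suml; apply: eq_bigr => j _.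
  have jn : (j <= n)%N by rewrite -ltnS.
  rewrite -(bin_fact jn) !natrM; apply: mulf_div_cross; try exact: fact_Qt_neq0.
  by move: jn; rewrite -bin_gt0; case: 'C(n, j) => // c _; apply: natr_Qt_neq0.
rewrite mulrA eulerian_binomial mulrBl opprB addrC subrK /=.
by case: n => [|n] /=; rewrite ?mul1r ?divr1 // !mul0r.
Qed.

Lemma exp_egf_deriv : fps_deriv exp_egf = fpsC (1 - t) * exp_egf.
Proof.
apply/fpsP => n; rewrite fcoefCM /= factS natrM exprS invfM -mulrnAr.
by rewrite -mulrnAl -[_ *+ n.+1]mulr_natr mulVf ?natr_Qt_neq0 // mul1r mulrA.
Qed.

Definition part_wt (k : nat) : LamQ := tint k *: sf_p k.
(** The series u of the overview; its constant term is 0 because [tint 0] is an empty sum. *)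
Definition u_ser : fps LamQ := Fps (fun k => k%:R^-1 *: part_wt k).

Lemma u_ser0 : u_ser 0%N = 0.
Proof. by rewrite /= /part_wt /tint big_ord0 scale0r scaler0. Qed.

Lemma u_serMn k : u_ser k.+1 *+ k.+1 = part_wt k.+1.
Proof. by rewrite -scaler_nat scalerA mulfV ?natr_Qt_neq0 // scale1r. Qed.

Definition at_u (f : fps Qt) : fps LamQ :=
  fps_comp u_ser (map_fps (GRing.in_alg LamQ) f).

(** [Phi] is sum_m A_m(t) u^m / m!, and [Kexp] is exp((1 - t) u). *)
Definition Phi := at_u eul_egf.
Definition Kexp := at_u exp_egf.

Lemma at_uM f g : at_u (f * g) = at_u f * at_u g.
Proof. by rewrite /at_u rmorphM fps_compM ?u_ser0. Qed.

Lemma at_uC c : at_u (fpsC c) = cst c.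
Proof. by rewrite /at_u map_fpsC fps_compC. Qed.

Lemma PhiE : (1 - cst t * Kexp) * Phi = cst ((1 - t) / t).
Proof.
rewrite -[RHS]at_uC -eul_egfE at_uM; congr (_ * _).
rewrite /Kexp -at_uC -at_uM /at_u raddfB /= raddfB /=; congr (_ - _).
by rewrite rmorph1 fps_comp1.
Qed.

Local Notation H := (sf_H Qt).
Local Notation P := (sf_P Qt).

Lemma mulr_algX (K : comNzRingType) (A : comAlgType K) (c : K) n (f : A) :
  c%:A ^+ n * f = c ^+ n *: f.
Proof.
by rewrite -[c%:A]/(GRing.in_alg A c) -rmorphXn /= mulr_algl.
Qed.

Lemma tint_geom k : (1 - t) * tint k = 1 - t ^+ k.
Proof. by rewrite -(opprB t) mulNr -subrX1 opprB. Qed.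

(** Since (1 - t) [k]_t = 1 - t^k, applying theta to (1 - t) u gives P(z) - P(tz). *)
Lemma theta_Kexp : theta Kexp = (P - fps_scale t%:A P) * Kexp.
Proof.
rewrite /Kexp /at_u theta_comp ?u_ser0 //.
have -> : fps_deriv (map_fps (GRing.in_alg LamQ) exp_egf) =
    map_fps (GRing.in_alg LamQ) (fps_deriv exp_egf).
  by apply/fpsP => n; rewrite /= scalerMnl.
rewrite -/(at_u _) exp_egf_deriv at_uM at_uC mulrC mulrA; congr (_ * _).
rewrite mulrC; apply/fpsP => -[|k]; rewrite fcoef_cstM fcoef_theta fcoefB
    fcoef_scale.
  by rewrite mulr0n scaler0 mulr0 subrr.
rewrite u_serMn scalerA tint_geom.
by rewrite mulr_algX scalerBl scale1r.
Qed.

Lemma theta_scale_H :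
  theta (fps_scale t%:A H) = fps_scale t%:A P * fps_scale t%:A H.
Proof. by rewrite theta_scale theta_sf_H rmorphM. Qed.

(** Both sides solve theta f = P f with constant term 1; on the right the two terms in P(tz)
    cancel. *)
Lemma Kexp_scale_H : H = Kexp * fps_scale t%:A H.
Proof.
apply: (@theta_ode_unique _ P) => //.
- move=> a n an0; rewrite -[a]scale1r -(mulVf (natr_Qt_neq0 n)) -scalerA.
  by rewrite scaler_nat an0 scaler0.
- exact: theta_sf_H.
- rewrite thetaM theta_Kexp theta_scale_H; ring.
- have K0 : Kexp 0%N = 1.
    by rewrite /= big_ord1 expr0 divr1 scale1r mul1r.
  by rewrite fcoefM0 K0 fcoef_scale expr0 !mul1r.
Qed.

Lemma Phi_scale_H : (fps_scale t%:A H - cst t * H) * Phi =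
  cst ((1 - t) / t) * fps_scale t%:A H.
Proof.
rewrite {2}Kexp_scale_H -PhiE; ring.
Qed.

(** * Expansion over partitions by number of parts *)

Definition parts_wt (s : seq nat) : LamQ := \prod_(k <- s) part_wt k.

Lemma parts_wtE s : parts_wt s = (\prod_(k <- s) tint k) *: sf_ppart s.
Proof. exact: scaler_prod. Qed.

Lemma perm_parts_rem s i : (i < size s)%N ->
  perm_eq (nth 0%N s i :: rem (nth 0%N s i) s) s.
Proof. by move=> si; rewrite perm_sym perm_to_rem ?mem_nth. Qed.

Lemma big_parts_rem (R : comNzRingType) (G : nat -> R) s (i : 'I_(size s)) :
  \prod_(j < size s | j != i) G (nth 0%N s j) =
  \prod_(k <- rem (nth 0%N s i) s) G k.
Proof.
rewrite -(big_mkord (fun j => j != i) (fun j => G (nth 0%N s j))) -big_filter.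
rewrite -(big_map (nth 0%N s) xpredT); apply: perm_big.
rewrite -(perm_cons (nth 0%N s i)) perm_sym.
apply: perm_trans (perm_parts_rem (ltn_ord i)) _.
rewrite -{1}(mkseq_nth 0%N s) -map_cons; apply: perm_map.
rewrite /index_iota subn0 -rem_filter ?iota_uniq //.
by apply: perm_to_rem; rewrite mem_iota ltn_ord.
Qed.

Definition size_sum (m : nat) : fps LamQ := Fps (fun n =>
  \sum_(mu : intpart n)
    (zpart mu)%:R^-1 *: (if size mu == m then parts_wt mu else 0)).

(** Marks one of the [m + 1] parts and removes it; a marked part k contributes [k]_t p_k / k, a
    coefficient of [u_ser]. *)
Lemma size_sumS m : size_sum m.+1 *+ m.+1 = u_ser * size_sum m.
Proof.
apply/fpsP => n; rewrite fcoefMn fcoefM big_ord_recl u_ser0 mul0r add0r.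
transitivity (\sum_(k < n) k.+1%:R^-1 *: (part_wt k.+1 *
    size_sum m (n - k.+1)%N)); last first.
  by apply: eq_bigr => k _; rewrite lift0 /= scalerAl.
rewrite -(sum_intpart_part natr_Qt_neq0 n part_wt
  (fun s => if size s == m then parts_wt s else 0)) /= -sumrMnl.
apply: eq_bigr => mu _; rewrite scalerMnr; congr (_ *: _).
transitivity (\sum_(i < size mu) (if size mu == m.+1 then parts_wt mu else 0)).
  by rewrite sumr_const card_ord; case: eqP => [->|_] //; rewrite !mul0rn.
apply: eq_bigr => i _; rewrite size_rem ?mem_nth //.
have sz : (0 < size mu)%N by apply: leq_ltn_trans (ltn_ord i).
rewrite -(eqn_add2r 1 (size mu).-1) !addn1 prednK //; case: ifP => _;
    last by rewrite mulr0.
rewrite /parts_wt -(perm_big _ (perm_parts_rem (ltn_ord i))) big_cons.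
by [].
Qed.

Lemma size_parts n (mu : intpart n) : (size mu <= n)%N.
Proof.
have /and3P[_ mu0 /eqP mun] := intpartP mu; rewrite -[leqRHS]mun.
elim: (mu : seq nat) mu0 {mun} => //= a s IH; rewrite inE negb_or eq_sym -lt0n.
by case/andP=> a0 /IH; apply: (@leq_add 1).
Qed.

Lemma size_sum0 : size_sum 0 = 1.
Proof.
apply/fpsP => n; rewrite fcoef1 /=; case: n => [|n].
  rewrite (big_pred1 (IntPart (isT : is_intpart 0 [::]))) => [|mu].
    by rewrite /zpart big_geq // invr1 scale1r /parts_wt big_nil.
  apply/esym/eqP/val_inj; apply: size0nil; apply/eqP.
  by rewrite -leqn0 size_parts.
rewrite big1 // => mu _; case: eqP => [/size0nil mu0|]; last by rewrite scaler0.
by have /and3P[_ _] := intpartP mu; rewrite mu0.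
Qed.

Lemma size_sum_exp m : size_sum m *+ m`! = u_ser ^+ m.
Proof.
elim: m => [|m IH]; first by rewrite size_sum0 expr0.
by rewrite factS mulrnA size_sumS -mulrnAr IH exprS.
Qed.

(** Partitions with [m] parts together give u^m / m!, by [size_sum_exp], and each inherits the
    factor A_m. *)
Lemma PhiE_parts n :
  Phi n = \sum_(mu : intpart n)
    (zpart mu)%:R^-1 *: (eulerian (size mu) *: parts_wt mu).
Proof.
transitivity (\sum_(m < n.+1) eulerian m *: size_sum m n).
  apply: eq_bigr => m _; rewrite /= -size_sum_exp mulr_algl fcoefMn.
  by rewrite -scaler_nat scalerA mulfVK ?fact_Qt_neq0.
under eq_bigr do rewrite /= scaler_sumr.
rewrite exchange_big; apply: eq_bigr => mu _ /=.
rewrite (bigD1 (Ordinal (size_parts mu : (size mu < n.+1)%N))) //= eqxx.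
rewrite scalerA mulrC -scalerA big1 ?addr0 // => m mmu.
case: eqP => [E|_]; last by rewrite !scaler0.
by case/eqP: mmu; apply: val_inj; rewrite /= E.
Qed.

Lemma scale_P_Phi n :
  (fps_scale t%:A P * Phi) n =
      \sum_(la : intpart n)
        ((eulerian (size la).-1 *
          \sum_(i < size la)
            (nth 0%N la i)%:R * t ^+ nth 0%N la i *
            \prod_(j < size la | j != i) tint (nth 0%N la j))
         / (zpart la)%:R) *: sf_ppart la.
Proof.
(* The factor [k] in [f] cancels the 1/k from [sum_intpart_part], leaving the coefficient t^k p_k of
   P(tz). *)
pose f k : LamQ := (k%:R * t ^+ k) *: sf_p k.
pose F s : LamQ := eulerian (size s) *: parts_wt s.
transitivity (\sum_(la : intpart n) (zpart la)%:R^-1 *: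
     \sum_(i < size la) f (nth 0%N la i) * F (rem (nth 0%N la i) la)).
  rewrite (sum_intpart_part natr_Qt_neq0 n) fcoefM big_ord_recl.
  rewrite fcoef_scale mulr0 mul0r add0r.
  apply: eq_bigr => k _; rewrite lift0 fcoef_scale mulr_algX PhiE_parts.
  by rewrite scalerAl /f scalerA mulKf ?natr_Qt_neq0.
apply: eq_bigr => la _; rewrite mulrC -scalerA; congr (_ *: _).
rewrite mulr_sumr scaler_suml; apply: eq_bigr => i _.
rewrite /F size_rem ?mem_nth // parts_wtE big_parts_rem.
rewrite /f -scalerAl -!scalerAr !scalerA; congr (_ *: _);
    first by rewrite mulrCA !mulrA.
by rewrite /sf_ppart -(perm_big _ (perm_parts_rem (ltn_ord i))) big_cons.
Qed.

(** * The generating function of Smirnov words *)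

(* The common denominator [(f(tz) - t f(z)) / (1 - t)]. *)
Definition smirnov_den (A : comAlgType Qt) (f : fps A) : fps A :=
  fpsC ((1 - t)^-1)%:A * (fps_scale t%:A f - fpsC t%:A * f).

Lemma onem_tV (A : comAlgType Qt) : (1 - t)^-1%:A * (1 - t%:A) = 1 :> A.
Proof.
rewrite mulr_algl scalerBr scalerA -scalerBl -[X in X - _]mulr1 -mulrBr.
by rewrite mulVf ?onem_t_neq0 // scale1r.
Qed.

Lemma fpsC_onem_tV (A : comAlgType Qt) :
  fpsC (1 - t)^-1%:A * (1 - fpsC t%:A) = 1 :> fps A.
Proof.
have := congr1 (@fpsC A) (onem_tV A).
rewrite (rmorphM (@fpsC A)) /= (rmorphB (@fpsC A)) /= (rmorph1 (@fpsC A)).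
by [].
Qed.

Lemma fpsC_tV (A : comAlgType Qt) : fpsC t^-1%:A * fpsC t%:A = 1 :> fps A.
Proof.
by rewrite -(rmorphM (@fpsC A)) mulr_algl scalerA mulVf ?t_neq0 //
    scale1r rmorph1.
Qed.

(** The division by 1 - t in [smirnov_den] brings the constant term to 1, so that this series can be
    inverted and cancelled. *)
Lemma smirnov_den0 (A : comAlgType Qt) (f : fps A) :
  f 0%N = 1 -> smirnov_den f 0%N = 1.
Proof.
move=> f0; rewrite fcoefCM fcoefB fcoefCM fcoef_scale f0 expr0 !mulr1.
by rewrite onem_tV.
Qed.

Lemma map_smirnov_den (A B : comAlgType Qt) (phi : {lrmorphism A -> B})
    (f : fps A) : map_fps phi (smirnov_den f) = smirnov_den (map_fps phi f).
Proof.
by rewrite rmorphM rmorphB rmorphM /= map_scale !map_fpsC /=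
  !rmorph_alg.
Qed.

Definition sf_E : fps LamQ := Fps sf_e.

Lemma sf_e0 : sf_e 0 = 1 :> LamQ.
Proof. by apply: symfunP => N; apply: mesym0E. Qed.

Lemma map_omega_E : map_fps (@omega Qt) sf_E = H.
Proof. by apply/fpsP => n; apply: omega_e. Qed.

(** Built as a quotient of series over [symfun], so that its coefficients are symmetric functions
    from the outset. *)
Definition Wser : fps LamQ :=
  cst t^-1 * theta (fps_scale t%:A sf_E) * fps_inv (smirnov_den sf_E).

Lemma WserE : smirnov_den sf_E * Wser = cst t^-1 * theta (fps_scale t%:A sf_E).
Proof.
by rewrite /Wser mulrCA fps_mulV ?mulr1 // smirnov_den0 //; apply: sf_e0.
Qed.

(** The product rule for theta(E(tz)) produces t times the sum in [cyclic_walk_series]. *)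
Lemma smirnov_den_cyclic_walk (A : comAlgType Qt) (x : nat -> A) N :
  let E := \prod_(0 <= c < N) (1 + fpsC (x c) * fpsX) in
  smirnov_den E * (fpsX * Fps (cyclic_walk t%:A x N)) =
  fpsC t^-1%:A * theta (fps_scale t%:A E).
Proof.
move=> E; rewrite /smirnov_den rmorph_prod /=.
under eq_bigr do rewrite scale_linear.
rewrite -mulrA cyclic_walk_series mulrA fpsC_onem_tV mul1r theta_prod mulr_sumr.
apply: eq_bigr => b _.
have -> : theta (1 + fpsC t%:A * (fpsC (x b) * fpsX)) =
    fpsC t%:A * (fpsC (x b) * fpsX).
  apply/fpsP => n; rewrite fcoef_theta fcoefD !fcoefCM fcoef1.
  by case: n => [|[|n]] /=; rewrite ?mulr0n ?mulr0 ?addr0 ?mul0rn // add0r.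
rewrite -[X in X * _ * _ = _]mul1r -(fpsC_tV A); ring.
Qed.

Lemma smirnov_den_Wtilde N :
  smirnov_den (Fps (mesym N Qt)) * Fps (fun n => if n ==
      0%N then 0 else Wtilde n N) =
  fpsC t^-1%:A * theta (fps_scale t%:A (Fps (mesym N Qt))).
Proof.
(* The empty word is discarded; coefficient [n + 1] comes from [cyclic_walk] at [n]. *)
have -> : Fps (fun n => if n == 0%N then 0 else Wtilde n N) =
    fpsX * Fps (cyclic_walk t%:A (@mvar Qt N) N).
  by apply/fpsP => -[|n]; rewrite fcoefXM //= cyclic_walk_words.
by rewrite -prod_mesym smirnov_den_cyclic_walk.
Qed.

(** Both series solve the same linear equation, whose leading factor [smirnov_den] can be
    cancelled. *)
Lemma map_restr_Wser N :
  map_fps (@sf_restr Qt N) Wser = Fps (fun n => if n ==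
      0%N then 0 else Wtilde n N).
Proof.
apply: (@fps_mulI _ (smirnov_den (Fps (mesym N Qt)))).
  by rewrite smirnov_den0 //; apply: mesym0E.
rewrite smirnov_den_Wtilde -[Fps (mesym N Qt)]/(map_fps (@sf_restr Qt N) sf_E).
rewrite -map_smirnov_den -rmorphM WserE rmorphM /=
    map_theta map_scale map_fpsC /=.
by [].
Qed.

(** Applying [omega] turns the equation [WserE] for E into one for H, and [Phi_scale_H] shows that
    the right-hand side solves it. *)
Lemma map_omega_Wser : map_fps (@omega Qt) Wser = fps_scale t%:A P * Phi.
Proof.
apply: (@fps_mulI _ (smirnov_den H)).
  rewrite smirnov_den0 // -map_omega_E /= sf_e0; exact: rmorph1.
rewrite -[X in smirnov_den X * map_fps _ _]map_omega_E -map_smirnov_den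
    -rmorphM.
rewrite WserE rmorphM /= map_theta map_scale map_omega_E map_fpsC /=.
rewrite !rmorph_alg theta_scale_H.
transitivity (cst (1 - t)^-1 * fps_scale t%:A P *
    ((fps_scale t%:A H - cst t * H) * Phi)); last by rewrite /smirnov_den; ring.
have cstE : cst (1 - t)^-1 * cst ((1 - t) / t) = cst t^-1.
  by rewrite -(rmorphM cst) mulKf ?onem_t_neq0.
rewrite Phi_scale_H -[fpsC _]/(cst t^-1) -cstE; ring.
Qed.

Theorem theorem4p1 (n : nat) (n_ge1 : (1 <= n)%N) :
  exists2 W : symfun Qt,
    forall N, W N = Wtilde n N
  & omega W =
      \sum_(la : intpart n)
        ((eulerian (size la).-1 *
          \sum_(i < size la)
            (nth 0%N la i)%:R * t ^+ nth 0%N la i *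
            \prod_(j < size la | j != i) tint (nth 0%N la j))
         / (zpart la)%:R) *: sf_ppart la.
Proof.
exists (Wser n) => [N|].
  have /fpsP/(_ n) := map_restr_Wser N.
  by rewrite /= -[_ == _]negbK -lt0n n_ge1.
by rewrite -scale_P_Phi -map_omega_Wser.
Qed.
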